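(* Let $p\ge 3$ and $\boldsymbol{\Sigma}=\mathrm{diag}(\sigma_1^2,\dots,\sigma_p^2)$ with $\sigma_1^2>\sigma_2^2>\dots>\sigma_p^2>0$. For $c_1>0$ and $c_2\ge 0$ consider the shrinkage estimator $$\boldsymbol{\delta}(\boldsymbol{x})=\left(\boldsymbol{I}-\boldsymbol{\Sigma}\,\frac{c_1}{c_2\sigma_1^2+\|\boldsymbol{x}\|^2}\right)\boldsymbol{x}.$$ (1) If $$0<c_1\le 2(p-2)\quad\text{and}\quad c_2\ge\max\left(0,\;p\left(\frac{c_1}{2(p-2)}-\frac{\sigma_p^2}{\sigma_1^2}\right)\right),$$ then $\boldsymbol{\delta}$ is ensemble minimax (with respect to $\mathcal{P}_\star$). (2) If $$2\left(\sum_{i=1}^p\frac{\sigma_i^4}{\sigma_1^4}-2\right)\ge c_1,$$ then $\boldsymbol{\delta}$ is ordinary minimax.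
   Context: One observes $\boldsymbol{X}\sim N_p(\boldsymbol{\theta},\boldsymbol{\Sigma})$ with $\boldsymbol{\Sigma}$ known and $\boldsymbol{\theta}\in\mathbb{R}^p$ unknown. An estimator is a measurable map $\boldsymbol{\delta}:\mathbb{R}^p\to\mathbb{R}^p$ (it only needs to be defined almost everywhere, e.g. off $\boldsymbol{x}=\boldsymbol{0}$). Its risk is $R(\boldsymbol{\delta},\boldsymbol{\theta})=E\left[\|\boldsymbol{\delta}(\boldsymbol{X})-\boldsymbol{\theta}\|^2\right]$, where $\boldsymbol{X}\sim N_p(\boldsymbol{\theta},\boldsymbol{\Sigma})$. An estimator $\boldsymbol{\delta}$ is (ordinary) minimax if $\sup_{\boldsymbol{\theta}\in\mathbb{R}^p}R(\boldsymbol{\delta},\boldsymbol{\theta})=\inf_{\boldsymbol{\delta}'}\sup_{\boldsymbol{\theta}\in\mathbb{R}^p}R(\boldsymbol{\delta}',\boldsymbol{\theta})$, the infimum being over all estimators. For $\tau\in(0,\infty)$ the ensemble risk is $$\bar R(\boldsymbol{\delta},\tau)=\int_{\mathbb{R}^p}R(\boldsymbol{\delta},\boldsymbol{\theta})\frac{1}{(2\pi\tau)^{p/2}}\exp\left(-\frac{\|\boldsymbol{\theta}\|^2}{2\tau}\right)d\boldsymbol{\theta}.$$ Let $\mathcal{P}_\star=\{N_p(\boldsymbol{0},\tau\boldsymbol{I}_p):\tau\in(0,\infty)\}$. An estimator $\boldsymbol{\delta}$ is called ensemble minimax (with respect to $\mathcal{P}_\star$) if $\sup_{\tau\in(0,\infty)}\bar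 R(\boldsymbol{\delta},\tau)=\inf_{\boldsymbol{\delta}'}\sup_{\tau\in(0,\infty)}\bar R(\boldsymbol{\delta}',\tau)$, the infimum being over all estimators $\boldsymbol{\delta}'$. *)

(* Defs.v *)
From HB Require Import structures.
From mathcomp Require Import all_boot all_order all_algebra.
From mathcomp Require Import all_classical all_reals all_analysis.
From mathcomp Require Import measurable_realfun.

Set Implicit Arguments.
Unset Strict Implicit.
Unset Printing Implicit Defensive.

Import Order.TTheory GRing.Theory Num.Theory.
Import numFieldNormedType.Exports.

Local Open Scope classical_set_scope.
Local Open Scope ring_scope.

(* Points of R^n are n-tuples, whose measurable sets are the Borel sets (the
   library puts the product sigma-algebra on tuples).  Linear algebra is done
   on the associated column vectors. *)
Definition colv (R : realType) (n : nat) (x : n.-tuple R) : 'cV[R]_n :=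
  \col_i tnth x i.

Definition tuple_of_col (R : realType) (n : nat) (v : 'cV[R]_n) : n.-tuple R :=
  [tuple v i ord0 | i < n].

(* The squared Euclidean norm; the norm that the library puts on matrices is
   the sup norm. *)
Definition sqnorm (R : realType) (n : nat) (v : 'cV[R]_n) : R :=
  \sum_i v i ord0 ^+ 2.

Section lebesgue_cons.
Context {R : realType} (n : nat).
Local Open Scope ereal_scope.

Definition cons_pair (x : measurableTypeR R * n.-tuple R) : n.+1.-tuple R :=
  [tuple of x.1 :: x.2].

Lemma measurable_cons_pair : measurable_fun [set: _] cons_pair.
Proof. exact: (measurable_cons measurable_fst measurable_snd). Qed.

Variable m : {sigma_finite_measure set (n.-tuple R) -> \bar R}.

Definition lebesgue_cons : set (n.+1.-tuple R) -> \bar R :=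
  pushforward (lebesgue_measure \x m) cons_pair.

Let lebesgue_cons0 : lebesgue_cons set0 = 0.
Proof. by rewrite /lebesgue_cons /pushforward preimage_set0 measure0. Qed.

Let lebesgue_cons_ge0 A : 0 <= lebesgue_cons A.
Proof. by rewrite /lebesgue_cons /pushforward measure_ge0. Qed.

Let lebesgue_cons_sigma_additive : semi_sigma_additive lebesgue_cons.
Proof.
move=> F mF tF mUF; rewrite /lebesgue_cons /pushforward preimage_bigcup.
apply: measure_semi_sigma_additive.
- move=> k; rewrite -[X in measurable X]setTI.
  exact: measurable_cons_pair.
- apply/trivIsetP => /= i j _ _ ij; rewrite -preimage_setI.
  by move/trivIsetP : tF => /(_ _ _ _ _ ij) ->//; rewrite preimage_set0.
- rewrite -preimage_bigcup -[X in measurable X]setTI.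
  exact: measurable_cons_pair.
Qed.

HB.instance Definition _ := isMeasure.Build _ _ _ lebesgue_cons
  lebesgue_cons0 lebesgue_cons_ge0 lebesgue_cons_sigma_additive.

Lemma preimage_cons_pair (A : set R) (B : set (n.-tuple R)) :
  cons_pair @^-1` [set x : n.+1.-tuple R |
    A (thead x) /\ B [tuple of behead x]] = A `*` B.
Proof.
apply/seteqP; split=> -[a b] /=.
- rewrite theadE => -[Aa Bb]; split => //=.
  by move: Bb; congr B; exact: val_inj.
- rewrite theadE => -[/= Aa Bb]; split => //.
  by move: Bb; congr B; exact: val_inj.
Qed.

Lemma measurable_cons_rect (A : set R) (B : set (n.-tuple R)) :
  measurable A -> measurable B ->
  measurable [set x : n.+1.-tuple R | A (thead x) /\ B [tuple of behead x]].
Proof.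
move=> mA mB; apply: measurableI.
- rewrite -[X in measurable X]setTI.
  exact: (@measurable_tnth _ R n.+1 ord0).
- rewrite -[X in measurable X]setTI.
  exact: measurable_behead.
Qed.

Lemma lebesgue_cons_rect (A : set R) (B : set (n.-tuple R)) :
  measurable A -> measurable B ->
  lebesgue_cons [set x | A (thead x) /\ B [tuple of behead x]] =
  lebesgue_measure A * m B.
Proof.
move=> mA mB.
by rewrite /lebesgue_cons /pushforward preimage_cons_pair product_measure1E.
Qed.

Let lebesgue_cons_sigma_finite : sigma_finite setT lebesgue_cons.
Proof.
have /sigma_finiteP[F [TF ndF Foo]] :=
  sigma_finiteT (@lebesgue_measure R : {sigma_finite_measure set _ -> \bar R}).
have /sigma_finiteP[G [TG ndG Goo]] := sigma_finiteT m.
exists (fun k => [set x : n.+1.-tuple R |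
    F k (thead x) /\ G k [tuple of behead x]]).
  apply/seteqP; split => // x _.
  have [i _ Fix] : (\bigcup_k F k) (thead x) by rewrite -TF.
  have [j _ Gjx] : (\bigcup_k G k) [tuple of behead x] by rewrite -TG.
  exists (maxn i j) => //; split.
  - by move: (thead x) Fix; exact/subsetPset/ndF/leq_maxl.
  - by move: [tuple of _] Gjx; exact/subsetPset/ndG/leq_maxr.
move=> k; have [mF Fk] := Foo k; have [mG Gk] := Goo k.
split; first exact: measurable_cons_rect.
by rewrite lebesgue_cons_rect// lte_mul_pinfty// ge0_fin_numE.
Qed.

HB.instance Definition _ := Measure_isSigmaFinite.Build _ _ _ lebesgue_cons
  lebesgue_cons_sigma_finite.

End lebesgue_cons.

(* Lebesgue measure on R^n, the n-fold product of lebesgue_measure. *)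
Fixpoint lebesgue_tuple (R : realType) (n : nat) :
    {sigma_finite_measure set (n.-tuple R) -> \bar R} :=
  match n with
  | 0 => @dirac _ (0.-tuple R) [tuple] R
  | n'.+1 => lebesgue_cons (lebesgue_tuple R n')
  end.

Lemma lebesgue_tuple_box (R : realType) (n : nat) (A : 'I_n -> set R) :
  (forall i, measurable (A i)) ->
  lebesgue_tuple R n [set x | forall i, A i (tnth x i)] =
  (\prod_(i < n) lebesgue_measure (A i))%E.
Proof.
elim: n A => [|n IHn] A mA.
  rewrite big_ord0 /= diracE.
  by rewrite mem_set//= => -[].
rewrite big_ord_recl -IHn//=.
rewrite -lebesgue_cons_rect//; last first.
  rewrite (_ : [set x | _] =
      \bigcap_(i in [set: 'I_n]) (fun x => tnth x i) @^-1` A (lift ord0 i)).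
    apply: fin_bigcap_measurable => // i _.
    rewrite -[X in measurable X]setTI.
    exact: measurable_tnth.
  by apply/seteqP; split => x /= Ax i; [move=> _|]; exact: Ax.
congr (lebesgue_cons _ _); apply/seteqP; split => x /=.
- move=> Ax; split; first exact: Ax.
  by move=> i; move: (Ax (lift ord0 i)); rewrite {1}(tuple_eta x) tnthS.
- move=> [A0 Ax] i; case: (unliftP ord0 i) => [j|] -> //.
  by rewrite (tuple_eta x) tnthS; exact: Ax.
Qed.

(* The density of N_n(theta, Sigma). *)
Definition mvnormal_pdf (R : realType) (n : nat) (theta : n.-tuple R)
    (Sigma : 'M[R]_n) (x : n.-tuple R) : R :=
  (Num.sqrt ((2 * pi) ^+ n * \det Sigma))^-1 *
  expR (- ((colv x - colv theta)^T *m invmx Sigma *m (colv x - colv theta))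
            ord0 ord0 / 2).

(* N_n(theta, Sigma); meaningful only if Sigma is symmetric positive
   definite. *)
Definition mvnormal (R : realType) (n : nat) (theta : n.-tuple R)
    (Sigma : 'M[R]_n) : set (n.-tuple R) -> \bar R :=
  fun A => (\int[lebesgue_tuple R n]_(x in A)
              (mvnormal_pdf theta Sigma x)%:E)%E.

Section mvnormal_measure.
Context {R : realType} (n : nat) (theta : n.-tuple R) (Sigma : 'M[R]_n).

Lemma mvnormal_pdf_ge0 x : 0 <= mvnormal_pdf theta Sigma x.
Proof. by rewrite mulr_ge0 ?expR_ge0// invr_ge0 sqrtr_ge0. Qed.

Lemma measurable_mvnormal_pdf :
  measurable_fun [set: _] (mvnormal_pdf theta Sigma).
Proof.
have mc (i : 'I_n) : measurable_fun [set: n.-tuple R]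
    (fun x => (colv x - colv theta) i ord0).
  under eq_fun do rewrite !mxE.
  by apply: measurable_funB => //; exact: measurable_tnth.
apply: measurable_funM => //; apply: measurableT_comp => //.
apply: measurable_funM => //; apply: measurableT_comp => //.
under eq_fun do rewrite mxE.
apply: measurable_sum => i; apply: measurable_funM => //.
under eq_fun do rewrite mxE.
apply: measurable_sum => j; apply: measurable_funM => //.
under eq_fun do rewrite [_^T _ _]mxE.
exact: mc.
Qed.

Let mvnormal0 : mvnormal theta Sigma set0 = 0%E.
Proof. by rewrite /mvnormal integral_set0. Qed.

Let mvnormal_ge0 A : (0 <= mvnormal theta Sigma A)%E.
Proof. by apply: integral_ge0 => x _; rewrite lee_fin mvnormal_pdf_ge0. Qed.

Let mvnormal_sigma_additive : semi_sigma_additive (mvnormal theta Sigma).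
Proof.
apply: semi_sigma_additive_nng_induced.
- by apply/measurable_EFinP; exact: measurable_mvnormal_pdf.
- by move=> x; rewrite lee_fin mvnormal_pdf_ge0.
Qed.

HB.instance Definition _ := isMeasure.Build _ _ _ (mvnormal theta Sigma)
  mvnormal0 mvnormal_ge0 mvnormal_sigma_additive.

End mvnormal_measure.

Section minimaxity.
Context {R : realType} (p : nat).
Local Open Scope ereal_scope.

(* An estimator defined only almost everywhere is represented by any of its
   measurable extensions: the risks below do not depend on the choice. *)
Definition estimator : set (p.-tuple R -> p.-tuple R) :=
  [set delta | measurable_fun [set: p.-tuple R] delta].

Variable Sigma : 'M[R]_p.

Definition risk (delta : p.-tuple R -> p.-tuple R) (theta : p.-tuple R) :
    \bar R :=
  \int[mvnormal theta Sigma]_x (sqnorm (colv (delta x) - colv theta))%:E.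

Definition ensemble_risk (delta : p.-tuple R -> p.-tuple R) (tau : R) :
    \bar R :=
  \int[lebesgue_tuple R p]_theta
    (risk delta theta *
     (((2 * pi * tau) `^ (p%:R / 2))^-1 *
      expR (- (sqnorm (colv theta) / (2 * tau))))%:E).

Definition max_risk (delta : p.-tuple R -> p.-tuple R) : \bar R :=
  ereal_sup [set risk delta theta | theta in [set: p.-tuple R]].

Definition max_ensemble_risk (delta : p.-tuple R -> p.-tuple R) : \bar R :=
  ereal_sup [set ensemble_risk delta tau | tau in `]0%R, +oo[].

Definition ordinary_minimax (delta : p.-tuple R -> p.-tuple R) : Prop :=
  estimator delta /\
  max_risk delta = ereal_inf [set max_risk delta' | delta' in estimator].

Definition ensemble_minimax (delta : p.-tuple R -> p.-tuple R) : Prop :=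
  estimator delta /\
  max_ensemble_risk delta =
    ereal_inf [set max_ensemble_risk delta' | delta' in estimator].

End minimaxity.

Definition diag_cov (R : realType) (p : nat) (sigma : 'I_p -> R) : 'M[R]_p :=
  diag_mx (\row_i sigma i ^+ 2).

(* If c2 = 0 the value at x = 0 is 0, by the convention 0^-1 = 0. *)
Definition shrinkage (R : realType) (n : nat) (sigma : 'I_n.+1 -> R)
    (c1 c2 : R) (x : n.+1.-tuple R) : n.+1.-tuple R :=
  tuple_of_col
    ((1%:M - (c1 / (c2 * sigma ord0 ^+ 2 + sqnorm (colv x))) *:
             diag_cov sigma) *m colv x).

(* Main.v *)
Require Import Defs.
From mathcomp Require Import all_boot all_order all_algebra.
From mathcomp Require Import all_classical all_reals all_analysis.
From mathcomp Require Import measurable_realfun ring lra.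

Set Implicit Arguments.
Unset Strict Implicit.
Unset Printing Implicit Defensive.

Import Order.TTheory GRing.Theory Num.Theory.
Import numFieldNormedType.Exports.

Local Open Scope classical_set_scope.
Local Open Scope ring_scope.

(** Both optimality claims follow from one value: for either notion of risk the
    minimax value is the trace of Sigma, so an estimator is minimax as soon as
    its (ensemble) risk never exceeds that trace.

    Lower bound.  Under the prior N(0, tau I) the coordinates theta_i are, given
    X, independent normal variables with variance
    sigma_i^2 tau / (sigma_i^2 + tau), so no estimator has ensemble risk below
    the sum of these variances ([bayes_risk_ge]).  As tau grows the sum tends to
    the trace ([max_ensemble_risk_ge]), and the supremum of the risk dominates
    the ensemble risks because these are averages of it
    ([max_ensemble_risk_le]).

    Upper bound.  Put S = |X|^2, and let c > 0 be the constant in the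
    denominator of the estimator.  Expanding the square, the mean of the i-th
    squared error involves E[(X_i - theta_i) X_i / (c + S)], which Stein's
    identity reduces to E[1 / (c + S)] and E[X_i^2 / (c + S)^2].  The outcome
    ([coord_risk_identity]) is
      risk_i + 2 c1 sigma_i^4 E[1 / (c + S)]
        = sigma_i^2 + c1 (c1 + 4) sigma_i^4 E[X_i^2 / (c + S)^2].
    Stein's identity is not obtained by differentiating in x.  Writing
    1 / (c + s) and 1 / (c + s)^2 as Laplace transforms turns each mean into an
    integral over t of Gaussian integrals that factor over the coordinates,
    because exp(- t S) times a diagonal Gaussian density is again one up to a
    factor ([integral_laplace]).  Under the integral over t the identity is
    algebraic ([stein_identity]).  All integrands are kept nonnegative, so
    that Tonelli's theorem applies and infinite values do no harm.

    For the ordinary risk, sum the identity over i and use that the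
    X_i^2 / (c + S)^2 add up to at most 1 / (c + S) ([risk_shrink_le]).  For the
    ensemble risk, average it over the prior; the means become those of a
    centred Gaussian vector with variances sigma_i^2 + tau, and each coordinate
    separately has averaged risk at most sigma_i^2 because
      (c1 + 4) E[X_i^2 / (c + S)^2] <= 2 E[1 / (c + S)].
    After the Laplace transform this compares two integrals over t, and the
    difference of the integrands dominates the derivative of a nonnegative
    function that vanishes at 0 ([coord_moment_le_inv_moment]).

    Both hypotheses on the constants survive an increase of c, so the case
    c = 0, where the estimator is singular at the origin, follows from c > 0 by
    Fatou's lemma ([risk_shrink_lim], [ensemble_risk_shrink_lim]). *)

(** * Comparing integrals by means of an antiderivative *)

Lemma derivable_continuous (R : realType) (f : R -> R) (x l : R) :
  is_derive x 1 f l -> {for x, continuous f}.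
Proof. by move=> [df _]; apply/differentiable_continuous/derivable1_diffP. Qed.

(** If g - f dominates the derivative of T, then on each segment the integral
    of g exceeds that of f by at least the increment of T.  The sequence e lets
    this increment be slightly negative, which is what is available when T only
    tends to 0 at the ends of the exhausting segments. *)
Lemma integral_le_of_derive (R : realType) (f g T T' : R -> R)
    (a b e : nat -> R) :
  (forall n, a n < b n) ->
  {homo a : m n / (m <= n)%N >-> n <= m} ->
  {homo b : m n / (m <= n)%N >-> m <= n} ->
  e @ \oo --> (0 : R) -> (forall n, T (a n) - e n <= T (b n)) ->
  (forall n x, x \in `[a n, b n] ->
    [/\ 0 <= f x, 0 <= g x & T' x <= g x - f x] /\
    [/\ {for x, continuous f}, {for x, continuous g},
        {for x, continuous T'} & is_derive x 1 T (T' x)]) ->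
  (\int[lebesgue_measure]_(x in \bigcup_n `[a n, b n]%classic) (f x)%:E <=
   \int[lebesgue_measure]_(x in \bigcup_n `[a n, b n]%classic) (g x)%:E)%E.
Proof.
move=> ab a_dec b_inc e0 eT H; set D := \bigcup_n `[a n, b n]%classic.
have cst_int (h : R -> R) n :
    (forall x, x \in `[a n, b n] -> {for x, continuous h}) ->
    lebesgue_measure.-integrable `[a n, b n] (EFin \o h).
  move=> ch; apply: continuous_compact_integrable; first exact: segment_compact.
  by apply: continuous_in_subspaceT => x; rewrite inE/= => /ch.
have nondecr : nondecreasing_seq (fun n => `[a n, b n]%classic : set R).
  move=> m n mn; apply/subsetPset => x /=; rewrite !in_itv/= => /andP[h1 h2].
  by rewrite (le_trans (a_dec _ _ mn))// (le_trans h2)// b_inc.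
have mh (h : R -> R) :
    (forall n x, x \in `[a n, b n] -> {for x, continuous h}) ->
    forall n, measurable_fun `[a n, b n] (EFin \o h).
  by move=> ch n; have /integrableP[] := cst_int h n (ch n).
have cf n x Hx := let: conj _ (And4 h _ _ _) := H n x Hx in h.
have cg n x Hx := let: conj _ (And4 _ h _ _) := H n x Hx in h.
have cT' n x Hx := let: conj _ (And4 _ _ h _) := H n x Hx in h.
have mf := mh f cf.
have mg := mh g cg.
have f0 n x : `[a n, b n]%classic x -> (0 <= (f x)%:E)%E.
  by move=> /(H n)[[? _ _] _]; rewrite lee_fin.
have g0 n x : `[a n, b n]%classic x -> (0 <= (g x)%:E)%E.
  by move=> /(H n)[[_ ? _] _]; rewrite lee_fin.
have mD : measurable D by apply: bigcupT_measurable => n; exact: measurable_itv.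
have gle n : (\int[lebesgue_measure]_(x in `[a n, b n]) (g x)%:E <=
    \int[lebesgue_measure]_(x in D) (g x)%:E)%E.
  apply: ge0_subset_integral => //; last by move=> x hx; exists n.
    exact/measurable_fun_bigcup.
  by move=> x [k _ hk]; exact: (g0 k).
have step n : (\int[lebesgue_measure]_(x in `[a n, b n]) (f x)%:E <=
    \int[lebesgue_measure]_(x in D) (g x)%:E + (e n)%:E)%E.
  have FT : (\int[lebesgue_measure]_(x in `[a n, b n]) (T' x)%:E =
      (T (b n))%:E - (T (a n))%:E)%E.
    apply: continuous_FTC2 => //.
    - apply: continuous_in_subspaceT => x; rewrite inE/= => /(H n)[_ []] //.
    - split.
      + move=> x /(subset_itv_oo_cc)/(H n)[_ [_ _ _ [//]]].
      + apply: cvg_at_right_filter.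
        have [|_ [_ _ _ dT]] := H n (a n); first by rewrite in_itv/= lexx ltW.
        exact: derivable_continuous dT.
      + apply: cvg_at_left_filter.
        have [|_ [_ _ _ dT]] := H n (b n); first by rewrite in_itv/= lexx ltW.
        exact: derivable_continuous dT.
    - move=> x /(subset_itv_oo_cc)/(H n)[_ [_ _ _ [? e']]].
      by rewrite derive1E e'.
  have I1 := cst_int f n (cf n).
  have I2 := cst_int g n (cg n).
  have I3 := cst_int T' n (cT' n).
  have : (\int[lebesgue_measure]_(x in `[a n, b n]) (f x)%:E +
          \int[lebesgue_measure]_(x in `[a n, b n]) (T' x)%:E <=
          \int[lebesgue_measure]_(x in `[a n, b n]) (g x)%:E)%E.
    rewrite -(integralD_EFin _ I1 I3)//; apply: le_integral => //.
    - exact: integrableD.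
    - move=> x; rewrite inE/= => /(H n)[[_ _ h] _]; rewrite lee_fin /=. lra.
  rewrite FT => hh.
  have := le_trans hh (gle n).
  rewrite -leeBrDr//.
  move=> /le_trans; apply; rewrite leeD2l//.
  by rewrite -EFinB -EFinN lee_fin; have := eT n; lra.
have If := @ge0_nondecreasing_set_cvg_integral _ _ _ _ _ lebesgue_measure
  nondecr (fun n => measurable_itv _) mf f0.
have Ig : (\int[lebesgue_measure]_(x in D) (g x)%:E + (e n)%:E)%E @[n --> \oo]
    --> (\int[lebesgue_measure]_(x in D) (g x)%:E)%E.
  rewrite -[X in _ --> X]adde0; apply: cvgeD; last 2 first.
  - exact: cvg_cst.
  - by apply: cvg_EFin => //; apply: nearW.
  by rewrite fin_num_adde_defl.
rewrite -(cvg_lim _ If)// -(cvg_lim _ Ig)//.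
apply: lee_lim; [exact: cvgP If|exact: cvgP Ig|].
by apply: nearW => n; exact: step.
Qed.

Lemma itv0y_bigcup_nat (R : realType) :
  `[0, +oo[%classic = \bigcup_n `[0, n.+1%:R]%classic :> set R.
Proof.
apply/seteqP; split=> [x|x [n _]] /=; rewrite !in_itv/= ?andbT.
  move=> x0; exists (Num.truncn x) => //=; rewrite in_itv/= x0/=.
  exact: ltW (truncnS_gt x).
by move=> /andP[].
Qed.

Lemma setT_bigcup_nat (R : realType) (m : R) :
  [set: R] = \bigcup_n `[m - n.+1%:R, m + n.+1%:R]%classic.
Proof.
apply/seteqP; split=> [x _|//].
exists (Num.truncn `|x - m|) => //=; rewrite in_itv/= -ler_distl.
exact: ltW (truncnS_gt _).
Qed.

Lemma integral_le_of_derive0y (R : realType) (f g T T' : R -> R) :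
  (forall x, 0 <= x -> T 0 <= T x) ->
  (forall x, 0 <= x ->
    [/\ 0 <= f x, 0 <= g x & T' x <= g x - f x] /\
    [/\ {for x, continuous f}, {for x, continuous g},
        {for x, continuous T'} & is_derive x 1 T (T' x)]) ->
  (\int[lebesgue_measure]_(x in `[0%R, +oo[) (f x)%:E <=
   \int[lebesgue_measure]_(x in `[0%R, +oo[) (g x)%:E)%E.
Proof.
move=> T0 H; rewrite itv0y_bigcup_nat.
apply: (@integral_le_of_derive R f g T T' (fun=> 0) (fun n => n.+1%:R)
   (fun=> 0)) => //.
- by move=> m n mn; rewrite ler_nat ltnS.
- exact: cvg_cst.
- by move=> n; rewrite subr0 T0.
- by move=> n x; rewrite in_itv/= => /andP[x0 _]; exact: H.
Qed.

(** The substitute for integration by parts on an unbounded domain: f and g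
    differ by the derivative of a function whose boundary terms vanish. *)
Lemma integral_eq_of_derive (R : realType) (f g T : R -> R)
    (a b e : nat -> R) :
  (forall n, a n < b n) ->
  {homo a : m n / (m <= n)%N >-> n <= m} ->
  {homo b : m n / (m <= n)%N >-> m <= n} ->
  e @ \oo --> (0 : R) -> (forall n, `|T (b n) - T (a n)| <= e n) ->
  (forall n x, x \in `[a n, b n] ->
    [/\ 0 <= f x, 0 <= g x, {for x, continuous f}, {for x, continuous g} &
        is_derive x 1 T (g x - f x)]) ->
  (\int[lebesgue_measure]_(x in \bigcup_n `[a n, b n]%classic) (f x)%:E =
   \int[lebesgue_measure]_(x in \bigcup_n `[a n, b n]%classic) (g x)%:E)%E.
Proof.
move=> ab a_dec b_inc e0 eT H; apply/eqP; rewrite eq_le; apply/andP; split.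
- apply: (@integral_le_of_derive R f g T (fun x => g x - f x) a b e) => //.
    by move=> n; have := eT n; rewrite ler_norml => /andP[]; lra.
  move=> n x /(H n)[f0 g0 cf cg dT]; split; split => //.
  by apply: continuousB.
- apply: (@integral_le_of_derive R g f (fun x => - T x) (fun x => f x - g x)
    a b e) => //.
    by move=> n; have := eT n; rewrite ler_norml => /andP[]; lra.
  move=> n x /(H n)[f0 g0 cf cg dT]; split; split => //.
    by apply: continuousB.
  by rewrite -opprB; exact: is_deriveN.
Qed.

(** * Integrals of exponentials and of Gaussians on the line *)

Lemma expRN_le_inv (R : realType) (u : R) : 0 < u -> expR (- u) <= u^-1.
Proof.
move=> u0; rewrite expRN lef_pV2 ?posrE ?expR_gt0//.
by apply: le_trans (expR_ge1Dx u); lra.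
Qed.

Lemma mul_expRN_le (R : realType) (u : R) : 0 < u -> u * expR (- u) <= 2 / u.
Proof.
move=> u0; rewrite expRN ler_pdivrMr ?expR_gt0// mulrAC ler_pdivlMr//.
have h : 1 + u ^+ 2 / 2 <= expR u := expR_ge1Dxn 1 (ltW u0).
have -> : u * u = 2 * (u ^+ 2 / 2) by field.
rewrite ler_pM2l//; lra.
Qed.

Lemma is_derive_expRNM (R : realType) (a x : R) :
  is_derive x 1 (fun t => expR (- (t * a))) (- (a * expR (- (x * a)))).
Proof. by apply: is_derive_eq; rewrite /GRing.scale/=; ring. Qed.

Lemma measurable_expRNM (R : realType) (D : set R) (a : R) :
  measurable_fun D (fun t => expR (- (t * a))).
Proof.
apply: measurable_funTS; apply: continuous_measurable_fun => x.
exact: derivable_continuous (is_derive_expRNM a x).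
Qed.

Lemma integral_expRN0y (R : realType) (a : R) : 0 < a ->
  (\int[lebesgue_measure]_(t in `[0%R, +oo[) (expR (- (t * a)))%:E =
   (a^-1)%:E)%E.
Proof.
move=> a0.
have dF (x : R) : is_derive x 1 (fun t => - a^-1 * expR (- (t * a)))
    (expR (- (x * a))).
  by apply: is_derive_eq; rewrite /GRing.scale/=; field; rewrite gt_eqF.
rewrite (@ge0_continuous_FTC2y _ _ (fun t => - a^-1 * expR (- (t * a))) _ 0)//.
- by rewrite mul0r oppr0 expR0 sub0e mulr1 -EFinN opprK.
- apply: continuous_subspaceT => x.
  exact: derivable_continuous (is_derive_expRNM a x).
- rewrite -(mulr0 (- a^-1)); apply: cvgM; first exact: cvg_cst.
  apply: (@cvg_comp _ _ _ (fun t => t * a) (fun z => expR (- z)) _ +oo).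
    exact: gt0_cvgMly.
  exact: cvgr_expR.
- apply: cvg_at_right_filter; exact: derivable_continuous (dF 0).
- by move=> x _; rewrite derive1E; case: (dF x).
Qed.

(** t exp(- t a) differs from exp(- t a) / a by the derivative of
    - t exp(- t a) / a, so that the previous integral gives this one. *)
Lemma integral_mul_expRN0y (R : realType) (a : R) : 0 < a ->
  (\int[lebesgue_measure]_(t in `[0%R, +oo[) (t * expR (- (t * a)))%:E =
   (a ^- 2)%:E)%E.
Proof.
move=> a0.
have dE := is_derive_expRNM a.
have dT (x : R) : is_derive x 1 (fun t => t * expR (- (t * a)) / a)
    (expR (- (x * a)) / a - x * expR (- (x * a))).
  by apply: is_derive_eq; rewrite /GRing.scale/=; field; rewrite gt_eqF.
transitivity (\int[lebesgue_measure]_(t in `[0%R, +oo[)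
   (expR (- (t * a)) / a)%:E)%E.
  rewrite itv0y_bigcup_nat.
  (* the boundary term is at most 2 / (a ^ 3 n) since u exp(- u) <= 2 / u *)
  apply: (@integral_eq_of_derive R _ _ (fun t => t * expR (- (t * a)) / a)
    (fun=> 0) (fun n => n.+1%:R) (fun n => 2 / a ^+ 3 * n.+1%:R^-1)) => //.
  - by move=> m n mn; rewrite ler_nat ltnS.
  - rewrite -(mulr0 (2 / a ^+ 3)); apply: cvgM; first exact: cvg_cst.
    exact: cvg_harmonic.
  - move=> n; rewrite !mul0r subr0.
    have n0 : 0 < n.+1%:R :> R by [].
    rewrite ger0_norm ?divr_ge0 ?mulr_ge0 ?expR_ge0 ?(ltW a0)//.
    have := mul_expRN_le (mulr_gt0 n0 a0).
    move=> /(ler_wpM2l (ltW (divr_gt0 ltr01 (exprn_gt0 2 a0)))).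
    by congr (_ <= _); field; rewrite ?gt_eqF.
  - move=> n x; rewrite in_itv/= => /andP[x0 _]; split => //.
    + by rewrite mulr_ge0 ?expR_ge0.
    + by rewrite divr_ge0 ?expR_ge0// ltW.
    + by apply: continuousM => //; exact: derivable_continuous (dE x).
    + apply: continuousM; last exact: cvg_cst.
      exact: derivable_continuous (dE x).
under eq_integral do rewrite mulrC EFinM.
rewrite ge0_integralZl//=.
- by rewrite integral_expRN0y// -EFinM -exprVn expr2.
- by apply/measurable_EFinP; exact: measurable_expRNM.
- by rewrite lee_fin invr_ge0 ltW.
Qed.

(** Parametrized by the variance rather than by the standard deviation, since
    variances add up and are rescaled below. *)
Definition gauss (R : realType) (v m x : R) : R :=
  (Num.sqrt (2 * pi * v))^-1 * expR (- ((x - m) ^+ 2 / (2 * v))).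

Lemma gaussE (R : realType) (v m x : R) : 0 < v ->
  gauss v m x = normal_pdf m (Num.sqrt v) x.
Proof.
move=> v0; rewrite /gauss normal_pdfE ?gt_eqF ?sqrtr_gt0//.
rewrite /normal_peak /normal_fun sqr_sqrtr ?(ltW v0)//.
rewrite (_ : v * pi *+ 2 = 2 * pi * v); last by rewrite -mulr_natl mulrC; ring.
by rewrite mulNr -(mulr_natl v).
Qed.

Lemma gauss_ge0 (R : realType) (v m x : R) : 0 <= gauss v m x.
Proof. by rewrite mulr_ge0 ?invr_ge0 ?sqrtr_ge0 ?expR_ge0. Qed.

Lemma is_derive_gauss (R : realType) (v m x : R) : 0 < v ->
  is_derive x 1 (gauss v m) (- ((x - m) / v) * gauss v m x).
Proof.
move=> v0; apply: is_derive_eq; rewrite /GRing.scale/= /gauss.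
set s := (Num.sqrt _)^-1; by field; rewrite gt_eqF.
Qed.

Lemma measurable_gauss (R : realType) (v m : R) D :
  measurable_fun D (gauss v m).
Proof.
apply: measurable_funTS; apply: measurable_funM => //.
apply: measurableT_comp => //; apply: measurableT_comp => //.
apply: measurable_funM => //; apply: measurable_funX.
exact: measurable_funB.
Qed.

Lemma integral_gauss (R : realType) (v m : R) : 0 < v ->
  (\int[lebesgue_measure]_x (gauss v m x)%:E = 1)%E.
Proof.
move=> v0; under eq_integral do rewrite gaussE//.
exact: integral_normal_pdf.
Qed.

(** The density satisfies v phi' = - (x - m) phi, so (x - a)^2 phi differs from
    the constant multiple (v + (a - m)^2) phi by an exact derivative. *)
Lemma integral_gauss_sqr (R : realType) (v m a : R) : 0 < v ->
  (\int[lebesgue_measure]_x ((x - a) ^+ 2 * gauss v m x)%:E =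
   (v + (a - m) ^+ 2)%:E)%E.
Proof.
move=> v0; have v_neq0 : v != 0 by rewrite gt_eqF.
have dG (x : R) := is_derive_gauss m x v0.
pose T (x : R) := v * (((x - m) - 2 * (a - m)) * gauss v m x).
have dT (x : R) : is_derive x 1 T
    ((v + (a - m) ^+ 2) * gauss v m x - (x - a) ^+ 2 * gauss v m x).
  by apply: is_derive_eq; rewrite /GRing.scale/=; field.
have cG (x : R) : {for x, continuous (gauss v m)}.
  exact: derivable_continuous (dG x).
have dP (x : R) : is_derive x 1 (fun x : R => (x - a) ^+ 2) (2 * (x - a)).
  by apply: is_derive_eq; rewrite /GRing.scale/=; ring.
transitivity (\int[lebesgue_measure]_x
  ((v + (a - m) ^+ 2) * gauss v m x)%:E)%E.
  (* on segments centred at m the part of T even about m has no increment *)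
  rewrite (setT_bigcup_nat m).
  pose K := 4 * v ^+ 2 * (Num.sqrt (2 * pi * v))^-1.
  apply: (@integral_eq_of_derive R _ _ T
    (fun n => m - n.+1%:R) (fun n => m + n.+1%:R)
    (fun n => K * n.+1%:R^-1)) => //.
  - by move=> n; rewrite ltrD2l gt0_cp.
  - by move=> i j ij; rewrite lerD2l lerN2 ler_nat ltnS.
  - by move=> i j ij; rewrite lerD2l ler_nat ltnS.
  - by rewrite -(mulr0 K); apply: cvgM; [exact: cvg_cst|exact: cvg_harmonic].
  - move=> n; have n0 : 0 < n.+1%:R :> R by [].
    have -> : T (m + n.+1%:R) - T (m - n.+1%:R) =
        2 * v * (Num.sqrt (2 * pi * v))^-1 *
        (n.+1%:R * expR (- (n.+1%:R ^+ 2 / (2 * v)))).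
      rewrite /T /gauss.
      rewrite (_ : m - n.+1%:R - m = - n.+1%:R); last by ring.
      rewrite (_ : m + n.+1%:R - m = n.+1%:R); last by ring.
      by rewrite sqrrN; ring.
    rewrite ger0_norm ?mulr_ge0 ?expR_ge0 ?invr_ge0 ?sqrtr_ge0 ?(ltW v0)//.
    have v2 : 0 < 2 * v by rewrite mulr_gt0.
    have := expRN_le_inv (divr_gt0 (exprn_gt0 2 n0) v2).
    move=> /(ler_wpM2l (ltW n0)).
    have h : 0 <= 2 * v * (Num.sqrt (2 * pi * v))^-1.
      by rewrite mulr_ge0 ?invr_ge0 ?sqrtr_ge0 ?(ltW v2).
    move=> /(ler_wpM2l h) /le_trans; apply.
    rewrite /K le_eqVlt; apply/orP; left.
    set s := (Num.sqrt _)^-1; apply/eqP; field; rewrite v_neq0/=.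
    by rewrite gt_eqF// ltr_wpDl.
  - move=> n x _; split=> //.
    + by rewrite mulr_ge0 ?sqr_ge0 ?gauss_ge0.
    + by rewrite mulr_ge0 ?gauss_ge0// addr_ge0 ?sqr_ge0 ?(ltW v0).
    + by apply: continuousM => //; exact: derivable_continuous (dP x).
    + by apply: continuousM => //; exact: cvg_cst.
under eq_integral do rewrite EFinM.
rewrite ge0_integralZl//=.
- by rewrite integral_gauss// mule1.
- by apply/measurable_EFinP; exact: measurable_gauss.
- by move=> x _; rewrite lee_fin gauss_ge0.
- by rewrite lee_fin addr_ge0 ?sqr_ge0 ?(ltW v0).
Qed.

Lemma integral_gauss_sqr0 (R : realType) (v m : R) : 0 < v ->
  (\int[lebesgue_measure]_x (x ^+ 2 * gauss v m x)%:E =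
   (v + m ^+ 2)%:E)%E.
Proof.
move=> v0; rewrite -[m in RHS]opprK sqrrN -(sub0r m) -integral_gauss_sqr//.
by apply: eq_integral => x _; rewrite subr0.
Qed.

(** Completing the square: tilting by exp(- t x^2) divides both parameters of
    the Gaussian by 1 + 2 t v. *)
Lemma expRM_gauss (R : realType) (v m t x : R) : 0 < v -> 0 <= t ->
  expR (- (t * x ^+ 2)) * gauss v m x =
  (Num.sqrt (1 + 2 * t * v))^-1 * expR (- (t * m ^+ 2 / (1 + 2 * t * v))) *
  gauss (v / (1 + 2 * t * v)) (m / (1 + 2 * t * v)) x.
Proof.
move=> v0 t0.
have r0 : 0 < 1 + 2 * t * v by rewrite ltr_wpDr// !mulr_ge0// ltW.
have pv : 0 <= 2 * pi * v by rewrite !mulr_ge0 ?pi_ge0// ltW.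
rewrite /gauss [2 * pi * (v / _)]mulrA (sqrtrM _ pv) sqrtrV ?(ltW r0)//.
set s := Num.sqrt _; set q := Num.sqrt _.
have q0 : q != 0 by rewrite gt_eqF// sqrtr_gt0.
rewrite [LHS]mulrCA [RHS](_ : _ = s^-1 *
  (expR (- (t * m ^+ 2 / (1 + 2 * t * v))) *
  expR (- ((x - m / (1 + 2 * t * v)) ^+ 2 / (2 * (v / (1 + 2 * t * v))))))).
  by rewrite -!expRD; congr (_ * expR _); field; rewrite !gt_eqF.
have s0 : s != 0 by rewrite gt_eqF// sqrtr_gt0 !mulr_gt0 ?pi_gt0.
by field; rewrite q0 s0.
Qed.

(** Bayes' rule for a normal mean with a centred normal prior: likelihood times
    prior is the marginal density of x times the posterior density of theta. *)
Lemma gaussM_gauss (R : realType) (s tau theta x : R) : 0 < s -> 0 < tau ->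
  gauss s theta x * gauss tau 0 theta =
  gauss (s + tau) 0 x *
  gauss (s * tau / (s + tau)) (tau / (s + tau) * x) theta.
Proof.
move=> s0 t0; have st0 : 0 < s + tau by rewrite addr_gt0.
rewrite /gauss ![_ * expR _ * _]mulrACA -!expRD; congr (_ * expR _).
  rewrite -!invfM -!sqrtrM ?mulr_ge0 ?pi_ge0 ?ltW//; congr ((Num.sqrt _)^-1).
  by field; rewrite gt_eqF.
by field; rewrite !gt_eqF.
Qed.

(** * Measurability, Tonelli's theorem on a subset and densities *)

(** Writing the inverse as x (x^2)^(-1) reduces it to a real power of a
    nonnegative number, and gives the value 0 at x = 0. *)
Lemma measurable_funV d (T : measurableType d) (R : realType) (D : set T)
    (f : T -> R) :
  measurable_fun D f -> measurable_fun D (fun x => (f x)^-1).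
Proof.
move=> mf; rewrite (_ : (fun x => _) = fun x => f x * (f x ^+ 2) `^ (-1)).
  apply: measurable_funM => //.
  apply: (measurableT_comp (measurable_powR (-1))).
  exact: measurable_funX.
apply/funext => x; rewrite powR_inv1 ?sqr_ge0//.
have [->|fx0] := eqVneq (f x) 0; first by rewrite invr0 mul0r.
by field.
Qed.

Lemma measurable_sqrt d (T : measurableType d) (R : realType) (D : set T)
    (f : T -> R) :
  measurable_fun D f -> measurable_fun D (fun x => Num.sqrt (f x)).
Proof.
move=> mf; apply: (measurableT_comp _ mf).
by apply: continuous_measurable_fun; exact: sqrt_continuous.
Qed.

Lemma ge0_fubini_tonelli_in d1 d2 (X : measurableType d1)
    (Y : measurableType d2) (R : realType)
    (mu : {sigma_finite_measure set X -> \bar R})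
    (nu : {sigma_finite_measure set Y -> \bar R}) (D : set Y)
    (f : X * Y -> \bar R) :
  measurable D -> measurable_fun [set: X * Y] f ->
  (forall x y, D y -> (0 <= f (x, y))%E) ->
  (\int[mu]_x \int[nu]_(y in D) f (x, y) =
   \int[nu]_(y in D) \int[mu]_x f (x, y))%E.
Proof.
move=> mD mf f0.
have mXD : measurable ([set: X] `*` D) by exact: measurableX.
pose g := f \_ ([set: X] `*` D).
have gE x y : g (x, y) = ((fun y => f (x, y)) \_ D) y.
  by rewrite /g !patchE/= in_setX in_setT.
transitivity (\int[mu]_x \int[nu]_y g (x, y))%E.
  apply: eq_integral => x _; rewrite integral_mkcond.
  by apply: eq_integral => y _; rewrite gE.
rewrite fubini_tonelli.
- rewrite [RHS]integral_mkcond; apply: eq_integral => y _.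
  rewrite patchE; case: ifPn => yD.
    by apply: eq_integral => x _; rewrite gE patchE yD.
  apply: integral0_eq => x _; by rewrite gE patchE (negbTE yD).
- by apply/(measurable_restrictT _ _).1 => //; exact: measurable_funTS.
- by apply: erestrict_ge0 => -[x y] [_ /= Dy]; exact: f0.
Qed.

Section density.
Import HBNNSimple.

(** Integration against a measure with a density h: both sides agree on simple
    functions and pass to increasing limits. *)
Lemma ge0_integral_density d (T : measurableType d) (R : realType)
    (mu nu : {measure set T -> \bar R}) (h : T -> R) (f : T -> \bar R) :
  measurable_fun [set: T] h -> (forall x, 0 <= h x) ->
  (forall A, measurable A -> nu A = \int[mu]_(x in A) (h x)%:E)%E ->
  measurable_fun [set: T] f -> (forall x, (0 <= f x)%E) ->
  (\int[nu]_x f x = \int[mu]_x (f x * (h x)%:E))%E.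
Proof.
move=> mh h0 nuE mf f0.
pose f_ := nnsfun_approx measurableT mf.
have f_cvg (x : T) : (f_ n x)%:E @[n --> \oo] --> f x.
  by apply: cvg_nnsfun_approx => // *; exact: f0.
have f_nd (x : T) : nondecreasing_seq (fun n => f_ n x).
  by move=> i j ij; exact/lefP/nd_nnsfun_approx.
have mf_ n : measurable_fun [set: T] (f_ n) by exact: measurable_funP.
transitivity (limn (fun n => \int[nu]_x (f_ n x)%:E)%E).
  rewrite -monotone_convergence//.
  - by apply: eq_integral => x _; apply/esym/cvg_lim => //; exact: f_cvg.
  - by move=> n; exact/measurable_EFinP.
  - by move=> n x _; rewrite lee_fin.
  - by move=> x _ i j ij; rewrite lee_fin; exact: f_nd.
transitivity (limn (fun n => \int[mu]_x ((f_ n x)%:E * (h x)%:E))%E);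
  last first.
  rewrite -monotone_convergence//.
  - apply: eq_integral => x _; apply/cvg_lim => //.
    by apply: cvgeZr => //; exact: f_cvg.
  - move=> n; apply: emeasurable_funM; exact/measurable_EFinP.
  - by move=> n x _; rewrite -EFinM lee_fin mulr_ge0.
  - move=> x _ i j ij; rewrite -!EFinM lee_fin ler_wpM2r//; exact: f_nd.
congr (limn _); apply/funext => n.
rewrite integralT_nnsfun sintegralE.
transitivity (\int[mu]_x (\sum_(k \in range (f_ n))
    (k%:E * ((\1_(f_ n @^-1` [set k]) x)%:E * (h x)%:E))))%E; last first.
  apply: eq_integral => x _.
  rewrite {1}fimfunE -fsumEFin// ge0_mule_fsuml; last first.
    by move=> k; rewrite EFinM nnfun_muleindic_ge0.
  by apply: eq_fsbigr => k _; rewrite EFinM muleA.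
rewrite ge0_integral_fsum//; last 2 first.
- move=> k; apply: measurable_funeM; apply: emeasurable_funM.
    exact/measurable_EFinP/measurable_indic.
  exact/measurable_EFinP.
- move=> k x _; rewrite muleA mule_ge0 ?lee_fin//.
  exact: nnfun_muleindic_ge0.
apply: eq_fsbigr => k; rewrite inE => -[y _ <-].
rewrite ge0_integralZl//; last 3 first.
- apply: emeasurable_funM; last exact/measurable_EFinP.
  exact/measurable_EFinP/measurable_indic.
- by move=> x _; rewrite mule_ge0 ?lee_fin.
- by rewrite lee_fin.
congr (_ * _)%E; rewrite nuE// integral_mkcond; apply: eq_integral => x _.
by rewrite epatch_indic muleC.
Qed.

End density.

(** * Lebesgue measure on tuples and diagonal Gaussian densities *)

Lemma integral_lebesgue_tupleS (R : realType) (n : nat)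
    (f : n.+1.-tuple R -> \bar R) :
  measurable_fun [set: _] f -> (forall x, (0 <= f x)%E) ->
  (\int[lebesgue_tuple R n.+1]_x f x =
   \int[lebesgue_measure]_x \int[lebesgue_tuple R n]_y
     f [tuple of x :: y])%E.
Proof.
move=> mf f0.
rewrite (ge0_integral_pushforward (@measurable_cons_pair R n))//=.
rewrite preimage_setT fubini_tonelli1//=.
by apply: measurableT_comp => //; exact: measurable_cons_pair.
Qed.

Lemma measurable_tnth_comp d (T : measurableType d) (R : realType) (n : nat)
    (a : T -> n.-tuple R) i :
  measurable_fun [set: T] a -> measurable_fun [set: T] (fun t => tnth (a t) i).
Proof.
move=> ma.
apply: (measurableT_comp (f := fun x : n.-tuple R => tnth x i)) => //.
exact: measurable_tnth.
Qed.

Lemma measurable_prod_tnth (R : realType) (n : nat) (f : 'I_n -> R -> R) :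
  (forall i, measurable_fun [set: R] (f i)) ->
  measurable_fun [set: n.-tuple R] (fun x => \prod_i f i (tnth x i)).
Proof.
move=> mf; apply: measurable_prod => i _.
by apply: (measurableT_comp (mf i)); exact: measurable_tnth.
Qed.

Lemma integral_prod_tnth (R : realType) (n : nat) (f : 'I_n -> R -> R)
    (c : 'I_n -> R) :
  (forall i, measurable_fun [set: R] (f i)) ->
  (forall i x, 0 <= f i x) ->
  (forall i, \int[lebesgue_measure]_x (f i x)%:E = (c i)%:E)%E ->
  (\int[lebesgue_tuple R n]_x (\prod_i f i (tnth x i))%:E =
   (\prod_i c i)%:E)%E.
Proof.
elim: n f c => [|n IHn] f c mf f0 fc.
  rewrite big_ord0.
  under eq_integral do rewrite big_ord0.
  by rewrite integral_cst//= diracT mule1.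
rewrite integral_lebesgue_tupleS; last 2 first.
- by apply/measurable_EFinP; exact: measurable_prod_tnth.
- by move=> x; rewrite lee_fin prodr_ge0.
have c0 i : 0 <= c i.
  by rewrite -lee_fin -fc integral_ge0// => x _; rewrite lee_fin.
transitivity (\int[lebesgue_measure]_x
   ((\prod_(i < n) c (lift ord0 i))%:E * (f ord0 x)%:E))%E.
  apply: eq_integral => x _.
  rewrite -(IHn (fun i => f (lift ord0 i)))// muleC -ge0_integralZl//=.
  - apply: eq_integral => y _; rewrite big_ord_recl EFinM; congr (_ * _)%E.
    by congr EFin; apply: eq_bigr => i _; rewrite tnthS.
  - apply/measurable_EFinP.
    exact: (measurable_prod_tnth (fun i => mf (lift ord0 i))).
  - by move=> y _; rewrite lee_fin prodr_ge0.
  - by rewrite lee_fin.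
rewrite ge0_integralZl//=.
- by rewrite fc -EFinM big_ord_recl mulrC.
- by apply/measurable_EFinP; exact: mf.
- by move=> y _; rewrite lee_fin.
- by rewrite lee_fin prodr_ge0.
Qed.

Lemma sqnorm_colv (R : realType) (n : nat) (x : n.-tuple R) :
  sqnorm (colv x) = \sum_i tnth x i ^+ 2.
Proof. by apply: eq_bigr => i _; rewrite mxE. Qed.

Lemma sqnorm_ge0 (R : realType) (n : nat) (v : 'cV[R]_n) : 0 <= sqnorm v.
Proof. by apply: sumr_ge0 => i _; exact: sqr_ge0. Qed.

Lemma measurable_sqnorm (R : realType) (n : nat) :
  measurable_fun [set: n.-tuple R] (fun x => sqnorm (colv x)).
Proof.
apply: measurable_sum => i; apply: measurable_funX.
by under eq_fun do rewrite !mxE; exact: measurable_tnth.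
Qed.

Lemma sqnormB_colv (R : realType) (n : nat) (x y : n.-tuple R) :
  sqnorm (colv x - colv y) = \sum_i (tnth x i - tnth y i) ^+ 2.
Proof. by apply: eq_bigr => i _; rewrite !mxE. Qed.

Lemma measurable_sqnormB d (T : measurableType d) (R : realType) (n : nat)
    (a b : T -> n.-tuple R) :
  measurable_fun [set: T] a -> measurable_fun [set: T] b ->
  measurable_fun [set: T] (fun t => sqnorm (colv (a t) - colv (b t))).
Proof.
move=> ma mb; apply: measurable_sum => i; apply: measurable_funX.
under eq_fun do rewrite !mxE.
by apply: measurable_funB; exact: measurable_tnth_comp.
Qed.

Definition gaussn (R : realType) (n : nat) (v m : 'I_n -> R) (x : n.-tuple R)
  : R := \prod_i gauss (v i) (m i) (tnth x i).

Lemma gaussn_ge0 (R : realType) (n : nat) (v m : 'I_n -> R) (x : n.-tuple R) :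
  0 <= gaussn v m x.
Proof. by apply: prodr_ge0 => i _; exact: gauss_ge0. Qed.

Lemma measurable_gaussn (R : realType) (n : nat) (v m : 'I_n -> R) :
  measurable_fun [set: n.-tuple R] (gaussn v m).
Proof.
apply: (@measurable_prod_tnth _ _ (fun i => gauss (v i) (m i))) => i.
exact: measurable_gauss.
Qed.

(** The other coordinates integrate to 1, leaving the integral for the i-th
    marginal. *)
Lemma integral_gaussn_coord (R : realType) (n : nat) (v m : 'I_n -> R) i
    (h : R -> R) (c : R) :
  (forall i, 0 < v i) -> measurable_fun [set: R] h -> (forall x, 0 <= h x) ->
  (\int[lebesgue_measure]_x (h x * gauss (v i) (m i) x)%:E = c%:E)%E ->
  (\int[lebesgue_tuple R n]_x (h (tnth x i) * gaussn v m x)%:E = c%:E)%E.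
Proof.
move=> v0 mh h0 hc.
transitivity (\int[lebesgue_tuple R n]_x (\prod_j
  ((if j == i then h (tnth x j) else 1) *
   gauss (v j) (m j) (tnth x j)))%:E)%E.
  apply: eq_integral => x _; congr EFin.
  by rewrite big_split/= -big_mkcond/= big_pred1_eq.
rewrite (@integral_prod_tnth R n
  (fun j y => (if j == i then h y else 1) * gauss (v j) (m j) y)
  (fun j => if j == i then c else 1)).
- by rewrite -big_mkcond/= big_pred1_eq.
- move=> j; apply: measurable_funM; last exact: measurable_gauss.
  by case: eqP.
- by move=> j y; case: eqP => _; rewrite mulr_ge0 ?gauss_ge0.
- move=> j; case: eqP => [->//|_].
  by under eq_integral do rewrite mul1r; rewrite integral_gauss.
Qed.

Lemma integral_gaussn (R : realType) (n : nat) (v m : 'I_n -> R) :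
  (forall i, 0 < v i) ->
  (\int[lebesgue_tuple R n]_x (gaussn v m x)%:E = 1)%E.
Proof.
move=> v0.
rewrite (@integral_prod_tnth R n (fun i => gauss (v i) (m i)) (fun=> 1)).
- by rewrite big1.
- by move=> i; exact: measurable_gauss.
- by move=> i x; exact: gauss_ge0.
- by move=> i; rewrite integral_gauss.
Qed.

Lemma sqrtr_prod (R : realType) (I : finType) (F : I -> R) :
  (forall i, 0 <= F i) -> Num.sqrt (\prod_i F i) = \prod_i Num.sqrt (F i).
Proof.
move=> F0; elim/big_rec2 : _ => [|i a b _ <-]; first exact: sqrtr1.
by rewrite sqrtrM.
Qed.

Lemma invmx_diag (F : fieldType) (n : nat) (d : 'I_n -> F) :
  (forall i, d i != 0) ->
  invmx (diag_mx (\row_i d i)) = diag_mx (\row_i (d i)^-1).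
Proof.
move=> d0; have dV : diag_mx (\row_i d i) *m diag_mx (\row_i (d i)^-1) = 1%:M.
  rewrite mulmx_diag -diag_const_mx; congr diag_mx.
  by apply/rowP => i; rewrite !mxE divff.
have [U _] := mulmx1_unit dV.
by rewrite -[LHS]mulmx1 -dV mulmxA mulVmx// mul1mx.
Qed.

Lemma mvnormal_pdf_diag (R : realType) (n : nat) (sigma : 'I_n -> R)
    (theta x : n.-tuple R) :
  (forall i, 0 < sigma i ^+ 2) ->
  mvnormal_pdf theta (diag_cov sigma) x =
  gaussn (fun i => sigma i ^+ 2) (tnth theta) x.
Proof.
move=> s0; rewrite /mvnormal_pdf /gaussn /gauss big_split/=; congr (_ * _).
  rewrite /diag_cov det_diag.
  rewrite (_ : (2 * pi) ^+ n = \prod_(i < n) (2 * pi)); last first.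
    by rewrite prodr_const card_ord.
  rewrite -big_split/= prodfV; congr (_^-1); rewrite sqrtr_prod.
    by apply: eq_bigr => i _; rewrite mxE.
  by move=> i; rewrite mxE mulr_ge0 ?sqr_ge0// mulr_ge0 ?pi_ge0.
rewrite -expR_sum; congr expR.
rewrite /diag_cov invmx_diag; last by move=> i; rewrite gt_eqF.
rewrite -mulmxA mul_diag_mx [(_ *m _) _ _]mxE mulNr mulr_suml -sumrN.
apply: eq_bigr => i _.
by rewrite !mxE; field; rewrite -sqrf_eq0 gt_eqF.
Qed.

Lemma prior_gaussn (R : realType) (n : nat) (tau : R) (theta : n.-tuple R) :
  0 < tau ->
  ((2 * pi * tau) `^ (n%:R / 2))^-1 *
    expR (- (sqnorm (colv theta) / (2 * tau))) =
  gaussn (fun=> tau) (fun=> 0) theta.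
Proof.
move=> t0; rewrite /gaussn /gauss big_split/= prodr_const card_ord.
have p0 : 0 <= 2 * pi * tau by rewrite !mulr_ge0 ?pi_ge0 ?ltW.
congr (_ * _).
  rewrite exprVn; congr (_^-1).
  by rewrite (mulrC n%:R) powRrM powR12_sqrt// powR_mulrn ?sqrtr_ge0.
rewrite -expR_sum; congr expR; rewrite /sqnorm mulr_suml -sumrN.
by apply: eq_bigr => i _; rewrite mxE subr0.
Qed.

(** * Means under a diagonal Gaussian law *)

Definition gmean (R : realType) (n : nat) (v m : 'I_n -> R)
    (f : n.-tuple R -> R) : \bar R :=
  (\int[lebesgue_tuple R n]_x (f x * gaussn v m x)%:E)%E.

Section gmean.
Context {R : realType} {n : nat} (v m : 'I_n -> R).
Implicit Types f g : n.-tuple R -> R.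

Lemma measurable_mul_gaussn f : measurable_fun [set: _] f ->
  measurable_fun [set: _] (fun x => (f x * gaussn v m x)%:E).
Proof.
move=> mf; apply/measurable_EFinP; apply: measurable_funM => //.
exact: measurable_gaussn.
Qed.

Lemma gmean_ge0 f : (forall x, 0 <= f x) -> (0 <= gmean v m f)%E.
Proof.
by move=> f0; apply: integral_ge0 => x _; rewrite lee_fin mulr_ge0 ?gaussn_ge0.
Qed.

Lemma gmeanD f g :
  measurable_fun [set: _] f -> measurable_fun [set: _] g ->
  (forall x, 0 <= f x) -> (forall x, 0 <= g x) ->
  (gmean v m (fun x => f x + g x)%R = gmean v m f + gmean v m g)%E.
Proof.
move=> mf mg f0 g0; rewrite -ge0_integralD//.
- by apply: eq_integral => x _; rewrite mulrDl EFinD.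
- by move=> x _; rewrite lee_fin mulr_ge0 ?gaussn_ge0.
- exact: measurable_mul_gaussn.
- by move=> x _; rewrite lee_fin mulr_ge0 ?gaussn_ge0.
- exact: measurable_mul_gaussn.
Qed.

Lemma gmeanZ (a : R) f :
  measurable_fun [set: _] f -> (forall x, 0 <= f x) -> 0 <= a ->
  (gmean v m (fun x => a * f x)%R = a%:E * gmean v m f)%E.
Proof.
move=> mf f0 a0; rewrite -ge0_integralZl//.
- by apply: eq_integral => x _; rewrite -mulrA EFinM.
- exact: measurable_mul_gaussn.
- by move=> x _; rewrite lee_fin mulr_ge0 ?gaussn_ge0.
Qed.

Lemma gmean_sum (I : Type) (r : seq I) (F : I -> n.-tuple R -> R) :
  (forall i, measurable_fun [set: _] (F i)) -> (forall i x, 0 <= F i x) ->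
  (gmean v m (fun x => \sum_(i <- r) F i x)%R =
   \sum_(i <- r) gmean v m (F i))%E.
Proof.
move=> mF F0; rewrite -ge0_integral_sum//.
- by apply: eq_integral => x _; rewrite mulr_suml -sumEFin.
- by move=> i; exact: measurable_mul_gaussn.
- by move=> i x _; rewrite lee_fin mulr_ge0 ?gaussn_ge0.
Qed.

Lemma gmean_le f g :
  measurable_fun [set: _] f -> measurable_fun [set: _] g ->
  (forall x, 0 <= f x) -> (forall x, f x <= g x) ->
  (gmean v m f <= gmean v m g)%E.
Proof.
move=> mf mg f0 fg; apply: ge0_le_integral => //.
- by move=> x _; rewrite lee_fin mulr_ge0 ?gaussn_ge0.
- exact: measurable_mul_gaussn.
- exact: measurable_mul_gaussn.
- by move=> x _; rewrite lee_fin ler_wpM2r ?gaussn_ge0.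
Qed.

Lemma eq_gmean f g : f =1 g -> gmean v m f = gmean v m g.
Proof. by move=> fg; apply: eq_integral => x _; rewrite fg. Qed.

Hypothesis v_gt0 : forall i, 0 < v i.

Lemma gmean_cst (a : R) : 0 <= a -> gmean v m (fun=> a) = a%:E.
Proof.
move=> a0; rewrite (_ : (fun=> a) = fun=> a * 1); last by rewrite mulr1.
rewrite (gmeanZ (f := fun=> 1))// /gmean.
by under eq_integral do rewrite mul1r; rewrite integral_gaussn// mule1.
Qed.

Lemma gmean_sqr i (a : R) :
  gmean v m (fun x => (tnth x i - a) ^+ 2) = (v i + (a - m i) ^+ 2)%:E.
Proof.
apply: (@integral_gaussn_coord _ _ _ _ _ (fun y => (y - a) ^+ 2)) => //.
- by apply: measurable_funX; exact: measurable_funB.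
- by move=> x; exact: sqr_ge0.
- exact: integral_gauss_sqr.
Qed.

End gmean.

Lemma gmean_fatou (R : realType) (n : nat) (v m : 'I_n -> R)
    (F : nat -> n.-tuple R -> R) (G : n.-tuple R -> R) (M : \bar R) :
  (forall k, measurable_fun [set: _] (F k)) -> (forall k x, 0 <= F k x) ->
  (forall x, F k x @[k --> \oo] --> G x) ->
  (forall k, (gmean v m (F k) <= M)%E) -> (gmean v m G <= M)%E.
Proof.
move=> mF F0 FG FM.
rewrite /gmean (_ : (fun x => _) = fun x =>
    limn_einf (fun k => (F k x * gaussn v m x)%:E)); last first.
  apply/funext => x.
  have h : (F k x * gaussn v m x)%:E @[k --> \oo] --> (G x * gaussn v m x)%:E.
    by apply: cvg_EFin; [exact: nearW|apply: cvgM => //; exact: cvg_cst].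
  by rewrite (is_cvg_limn_einfE (cvgP _ h)) (cvg_lim _ h).
apply: le_trans (fatou _ _ _ _) _ => //.
- by move=> k; exact: measurable_mul_gaussn.
- by move=> k x _; rewrite lee_fin mulr_ge0 ?gaussn_ge0.
rewrite limn_einf_lim; apply: lime_le; first exact: is_cvg_einfs.
apply: nearW => k; apply: (le_trans _ (FM k)).
by apply: ereal_inf_lbound; exists k => /=.
Qed.

(** * Exponential tilting and Laplace transforms *)

Section laplace.
Context {R : realType} {n : nat} (v m : 'I_n -> R).
Hypothesis v_gt0 : forall i, 0 < v i.

(** The mean of exp(- t |X|^2), hence the normalizing factor of the tilted law;
    [tilt_var] and [tilt_mean] are the parameters of that law. *)
Definition tilt_factor (t : R) : R :=
  \prod_i ((Num.sqrt (1 + 2 * t * v i))^-1 *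
           expR (- (t * m i ^+ 2 / (1 + 2 * t * v i)))).

Definition tilt_var (t : R) (i : 'I_n) : R := v i / (1 + 2 * t * v i).

Definition tilt_mean (t : R) (i : 'I_n) : R := m i / (1 + 2 * t * v i).

Lemma tilt_den_gt0 t i : 0 <= t -> 0 < 1 + 2 * t * v i.
Proof.
by move=> t0; rewrite ltr_wpDr// mulr_ge0 ?(ltW (v_gt0 i))// mulr_ge0.
Qed.

Lemma tilt_var_gt0 t i : 0 <= t -> 0 < tilt_var t i.
Proof. by move=> t0; rewrite divr_gt0 ?tilt_den_gt0. Qed.

Lemma tilt_factor_ge0 t : 0 <= tilt_factor t.
Proof.
by apply: prodr_ge0 => i _; rewrite mulr_ge0 ?invr_ge0 ?sqrtr_ge0 ?expR_ge0.
Qed.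

Lemma measurable_tilt_den (D : set R) i :
  measurable_fun D (fun t => 1 + 2 * t * v i).
Proof.
by apply: measurable_funD => //; apply: measurable_funM => //.
Qed.

Lemma measurable_tilt_var (D : set R) i :
  measurable_fun D (fun t => tilt_var t i).
Proof.
apply: measurable_funM => //; apply: measurable_funV.
exact: measurable_tilt_den.
Qed.

Lemma measurable_tilt_mean (D : set R) i :
  measurable_fun D (fun t => tilt_mean t i).
Proof.
apply: measurable_funM => //; apply: measurable_funV.
exact: measurable_tilt_den.
Qed.

Lemma measurable_tilt_factor (D : set R) : measurable_fun D tilt_factor.
Proof.
apply: measurable_prod => i _; apply: measurable_funM.
  by apply/measurable_funV/measurable_sqrt; exact: measurable_tilt_den.
apply: measurableT_comp => //; apply: measurableT_comp => //.
apply: measurable_funM; first by apply: measurable_funM.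
by apply/measurable_funV; exact: measurable_tilt_den.
Qed.

Lemma expRM_gaussn (t : R) (x : n.-tuple R) : 0 <= t ->
  expR (- (t * sqnorm (colv x))) * gaussn v m x =
  tilt_factor t * gaussn (tilt_var t) (tilt_mean t) x.
Proof.
move=> t0; rewrite sqnorm_colv mulr_sumr -sumrN expR_sum -!big_split/=.
by apply: eq_bigr => i _; rewrite expRM_gauss.
Qed.

(** If phi is the Laplace transform of q, the mean of h(X_i) phi(c + |X|^2) is
    an integral over t in which the coordinates have become independent again:
    exchange the integrals and absorb exp(- t |X|^2) into the density.  G(t) is
    the mean of h under the i-th tilted marginal. *)
Lemma integral_laplace (i : 'I_n) (c : R) (q phi h G : R -> R) :
  0 < c ->
  measurable_fun [set: R] q -> (forall t : R, 0 <= t -> 0 <= q t) ->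
  (forall s : R, 0 < s ->
    (\int[lebesgue_measure]_(t in `[0%R, +oo[) (q t * expR (- (t * s)))%:E =
     (phi s)%:E)%E) ->
  measurable_fun [set: R] h -> (forall x, 0 <= h x) ->
  (forall t : R, 0 <= t -> (\int[lebesgue_measure]_x
    (h x * gauss (tilt_var t i) (tilt_mean t i) x)%:E = (G t)%:E)%E) ->
  (\int[lebesgue_tuple R n]_x
    (h (tnth x i) * phi (c + sqnorm (colv x)) * gaussn v m x)%:E =
   \int[lebesgue_measure]_(t in `[0%R, +oo[)
    (q t * expR (- (t * c)) * tilt_factor t * G t)%:E)%E.
Proof.
move=> c0 mq q0 qphi mh h0 hG.
pose F (z : n.-tuple R * R) : R := h (tnth z.1 i) * gaussn v m z.1 *
  (q z.2 * expR (- (z.2 * (c + sqnorm (colv z.1))))).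
have hg0 x : 0 <= h (tnth x i) * gaussn v m x.
  by rewrite mulr_ge0 ?gaussn_ge0.
have mF : measurable_fun [set: n.-tuple R * R] F.
  apply: measurable_funM; apply: measurable_funM.
  - by apply: (measurableT_comp mh); apply: measurable_tnth_comp.
  - exact: (measurableT_comp (measurable_gaussn v m)).
  - exact: (measurableT_comp mq).
  - apply: measurableT_comp => //; apply: measurableT_comp => //.
    apply: measurable_funM => //; apply: measurable_funD => //.
    exact: (measurableT_comp (@measurable_sqnorm R n)).
transitivity (\int[lebesgue_tuple R n]_x
    \int[lebesgue_measure]_(t in `[0%R, +oo[) (F (x, t))%:E)%E.
  apply: eq_integral => x _.
  have S0 : 0 < c + sqnorm (colv x) by rewrite ltr_wpDr ?sqnorm_ge0.
  under eq_integral do rewrite /F/= EFinM.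
  rewrite ge0_integralZl//=.
  - by rewrite qphi// -EFinM mulrAC.
  - apply/measurable_EFinP; apply: measurable_funM.
      exact: measurable_funTS.
    exact: measurable_expRNM.
  - move=> t; rewrite /= in_itv/= andbT => t0.
    by rewrite lee_fin mulr_ge0 ?expR_ge0 ?q0.
  - by rewrite lee_fin.
rewrite (@ge0_fubini_tonelli_in _ _ _ _ _ (lebesgue_tuple R n)
  lebesgue_measure _ (fun z => (F z)%:E))//.
- apply: eq_integral => t; rewrite inE/= in_itv/= andbT => t0.
  transitivity (\int[lebesgue_tuple R n]_x
    ((q t * expR (- (t * c)) * tilt_factor t)%:E *
     (h (tnth x i) * gaussn (tilt_var t) (tilt_mean t) x)%:E))%E.
    apply: eq_integral => x _; rewrite -EFinM; congr EFin.
    rewrite [RHS](_ : _ = q t * expR (- (t * c)) * h (tnth x i) *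
      (tilt_factor t * gaussn (tilt_var t) (tilt_mean t) x)); last by ring.
    by rewrite -expRM_gaussn// /F/= mulrDr opprD expRD; ring.
  rewrite ge0_integralZl//=.
  - rewrite (integral_gaussn_coord (c := G t))//.
      by move=> j; exact: tilt_var_gt0.
    exact: hG.
  - apply/measurable_EFinP; apply: measurable_funM;
      last exact: measurable_gaussn.
    by apply: (measurableT_comp mh); exact: measurable_tnth.
  - by move=> x _; rewrite lee_fin mulr_ge0 ?gaussn_ge0.
  - by rewrite lee_fin !mulr_ge0 ?q0 ?expR_ge0 ?tilt_factor_ge0.
- by apply/measurable_EFinP.
- move=> x t; rewrite /= in_itv/= andbT => t0.
  by rewrite lee_fin mulr_ge0// mulr_ge0 ?q0 ?expR_ge0.
Qed.

End laplace.

(** * Inverse moments of a Gaussian vector *)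

Section inverse_moments.
Context {R : realType} {n : nat} (v m : 'I_n -> R) (c : R).
Hypothesis v_gt0 : forall i, 0 < v i.
Hypothesis c_gt0 : 0 < c.

Definition inv_moment : \bar R :=
  gmean v m (fun x => (c + sqnorm (colv x))^-1).

Definition coord_moment (i : 'I_n) : \bar R :=
  gmean v m (fun x => tnth x i ^+ 2 * (c + sqnorm (colv x)) ^- 2).

Lemma shift_sqnorm_gt0 (x : n.-tuple R) : 0 < c + sqnorm (colv x).
Proof. by rewrite ltr_wpDr ?sqnorm_ge0. Qed.

Lemma measurable_inv_sqnorm :
  measurable_fun [set: n.-tuple R] (fun x => (c + sqnorm (colv x))^-1).
Proof.
apply: measurable_funV; apply: measurable_funD => //.
exact: measurable_sqnorm.
Qed.

Lemma measurable_coord_moment i :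
  measurable_fun [set: n.-tuple R]
    (fun x => tnth x i ^+ 2 * (c + sqnorm (colv x)) ^- 2).
Proof.
apply: measurable_funM; first by apply: measurable_funX; exact: measurable_tnth.
apply: measurable_funV; apply: measurable_funX.
by apply: measurable_funD => //; exact: measurable_sqnorm.
Qed.

(** This bound and the next one make the moments finite, so that the identities
    below can be solved for the risk. *)
Lemma inv_moment_le : (inv_moment <= (c^-1)%:E)%E.
Proof.
rewrite -(gmean_cst m v_gt0 (a := c^-1)) ?invr_ge0 ?(ltW c_gt0)//.
rewrite /inv_moment; apply: gmean_le => //; first exact: measurable_inv_sqnorm.
- by move=> x; rewrite invr_ge0 ltW ?shift_sqnorm_gt0.
- move=> x; rewrite lef_pV2 ?posrE ?shift_sqnorm_gt0//.
  by rewrite lerDl sqnorm_ge0.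
Qed.

Lemma coord_moment_le i : (coord_moment i <= inv_moment)%E.
Proof.
rewrite /coord_moment /inv_moment; apply: gmean_le.
- exact: measurable_coord_moment.
- exact: measurable_inv_sqnorm.
- by move=> x; rewrite mulr_ge0 ?sqr_ge0// invr_ge0 sqr_ge0.
- move=> x; have S0 := shift_sqnorm_gt0 x.
  rewrite expr2 invfM mulrA ler_piMl ?invr_ge0 ?(ltW S0)//.
  rewrite ler_pdivrMr// mul1r sqnorm_colv (bigD1 i)//=.
  have : 0 <= \sum_(j < n | j != i) tnth x j ^+ 2.
    by apply: sumr_ge0 => j _; exact: sqr_ge0.
  by move: c_gt0; rewrite -expr2; lra.
Qed.

Lemma inv_moment_laplace (i : 'I_n) :
  inv_moment = (\int[lebesgue_measure]_(t in `[0%R, +oo[)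
    (expR (- (t * c)) * tilt_factor v m t)%:E)%E.
Proof.
have L := @integral_laplace R n v m v_gt0 i c (fun=> 1) (fun s => s^-1)
  (fun=> 1) (fun=> 1) c_gt0.
rewrite /inv_moment /gmean; transitivity (\int[lebesgue_tuple R n]_x
  (1 * (c + sqnorm (colv x))^-1 * gaussn v m x)%:E)%E.
  by apply: eq_integral => x _; rewrite mul1r.
rewrite L//.
- by apply: eq_integral => t _; rewrite mul1r mulr1.
- move=> s s0; under eq_integral do rewrite mul1r.
  exact: integral_expRN0y.
- move=> t t0; under eq_integral do rewrite mul1r.
  by rewrite integral_gauss// tilt_var_gt0.
Qed.

Lemma coord_moment_laplace (i : 'I_n) :
  coord_moment i = (\int[lebesgue_measure]_(t in `[0%R, +oo[)
    (t * expR (- (t * c)) * tilt_factor v m t *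
     (tilt_var v t i + tilt_mean v m t i ^+ 2))%:E)%E.
Proof.
apply: (@integral_laplace R n v m v_gt0 i c id (fun s => s ^- 2)
  (fun y => y ^+ 2)) => //.
- exact: integral_mul_expRN0y.
- by move=> x; exact: sqr_ge0.
- move=> t t0.
  by rewrite integral_gauss_sqr0// tilt_var_gt0.
Qed.

(** Stein's identity for x_i / (c + |x|^2), written without subtraction by
    means of 2 (x - m) x = (x - m)^2 + x^2 - m^2.  After the Laplace transform
    it is the relation, in the tilted mean m' = m / (1 + 2 t v) and variance
    w = v / (1 + 2 t v),
      (w + (m - m')^2) + (w + m'^2) + 4 v t (w + m'^2) = m^2 + 2 v. *)
Lemma stein_identity (i : 'I_n) :
  (gmean v m (fun x => ((tnth x i - m i) ^+ 2 + tnth x i ^+ 2) *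
                       (c + sqnorm (colv x))^-1)%R +
   (4 * v i)%:E * coord_moment i =
   (m i ^+ 2 + 2 * v i)%:E * inv_moment)%E.
Proof.
have mK (D : set R) :
    measurable_fun D (fun t => expR (- (t * c)) * tilt_factor v m t).
  apply: measurable_funM; first exact: measurable_expRNM.
  exact: measurable_tilt_factor.
have v0 := v_gt0 i.
rewrite (inv_moment_laplace i) coord_moment_laplace.
rewrite [X in (X + _)%E](_ : _ = (\int[lebesgue_measure]_(t in `[0%R, +oo[)
    (expR (- (t * c)) * tilt_factor v m t *
     ((tilt_var v t i + (m i - tilt_mean v m t i) ^+ 2) +
      (tilt_var v t i + tilt_mean v m t i ^+ 2)))%:E)%E); last first.
  rewrite /gmean (@integral_laplace R n v m v_gt0 i c (fun=> 1) (fun s => s^-1)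
    (fun y => (y - m i) ^+ 2 + y ^+ 2) (fun t =>
     (tilt_var v t i + (m i - tilt_mean v m t i) ^+ 2) +
      (tilt_var v t i + tilt_mean v m t i ^+ 2)))//.
  - by apply: eq_integral => t _; rewrite mul1r.
  - by move=> s s0; under eq_integral do rewrite mul1r; exact: integral_expRN0y.
  - apply: measurable_funD; apply: measurable_funX => //.
    exact: measurable_funB.
  - by move=> x; rewrite addr_ge0 ?sqr_ge0.
  - move=> t t0; have w0 := tilt_var_gt0 v_gt0 i t0.
    under eq_integral do rewrite mulrDl EFinD.
    rewrite ge0_integralD//.
    + by rewrite integral_gauss_sqr0// integral_gauss_sqr.
    + by move=> x _; rewrite lee_fin mulr_ge0 ?sqr_ge0 ?gauss_ge0.
    + apply/measurable_EFinP; apply: measurable_funM;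
        last exact: measurable_gauss.
      by apply: measurable_funX; exact: measurable_funB.
    + by move=> x _; rewrite lee_fin mulr_ge0 ?sqr_ge0 ?gauss_ge0.
    + apply/measurable_EFinP; apply: measurable_funM;
        last exact: measurable_gauss.
      exact: measurable_funX.
have K0 t : 0 <= expR (- (t * c)) * tilt_factor v m t.
  by rewrite mulr_ge0 ?expR_ge0 ?tilt_factor_ge0.
have mw (D : set R) := measurable_tilt_var v i (D := D).
have mm (D : set R) := measurable_tilt_mean v m i (D := D).
have mQ : measurable_fun (`[0, +oo[%classic : set R) (fun t : R =>
    t * expR (- (t * c)) * tilt_factor v m t *
     (tilt_var v t i + tilt_mean v m t i ^+ 2)).
  apply: measurable_funM.
    apply: measurable_funM; last exact: measurable_tilt_factor.
    by apply: measurable_funM => //; exact: measurable_expRNM.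
  by apply: measurable_funD => //; exact: measurable_funX.
have Q0 (t : R) : `[0, +oo[%classic t ->
    0 <= t * expR (- (t * c)) * tilt_factor v m t *
     (tilt_var v t i + tilt_mean v m t i ^+ 2).
  rewrite /= in_itv/= andbT => t0.
  rewrite !mulr_ge0 ?expR_ge0 ?tilt_factor_ge0//.
  by rewrite addr_ge0 ?sqr_ge0// ltW ?tilt_var_gt0.
have v4 : 0 <= 4 * v i by rewrite mulr_ge0// ltW.
rewrite -ge0_integralZl//=; last exact/measurable_EFinP.
rewrite -ge0_integralZl//=; last 3 first.
- by apply/measurable_EFinP; exact: mK.
- by move=> t _; rewrite lee_fin.
- by rewrite lee_fin addr_ge0 ?sqr_ge0// mulr_ge0// ltW.
rewrite -ge0_integralD//=; last 4 first.
- move=> t; rewrite /= in_itv/= andbT => t0.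
  have w0 := ltW (tilt_var_gt0 v_gt0 i t0).
  by rewrite lee_fin mulr_ge0// !addr_ge0 ?sqr_ge0.
- apply/measurable_EFinP; apply: measurable_funM; first exact: mK.
  apply: measurable_funD; (apply: measurable_funD; first exact: mw);
    apply: measurable_funX.
    by apply: measurable_funB => //; exact: mm.
  exact: mm.
- by move=> t t0; rewrite mule_ge0// lee_fin Q0.
- by apply: measurable_funeM; exact/measurable_EFinP.
apply: eq_integral => t; rewrite inE/= in_itv/= andbT => t0.
rewrite -!EFinM -EFinD; congr EFin; rewrite /tilt_var /tilt_mean.
have := tilt_den_gt0 v_gt0 i t0.
by set e := expR _; set k := tilt_factor _ _ _ => r0; field; rewrite gt_eqF.
Qed.

End inverse_moments.

(** * The risk of one coordinate of a shrinkage estimator *)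

Lemma fin_le (R : realType) (x : \bar R) (r : R) : (0 <= x -> x <= r%:E ->
  exists2 s : R, x = s%:E & (0 <= s)%R)%E.
Proof.
by case: x => [s| |]//; rewrite lee_fin => s0 _; exists s.
Qed.

Section risk_identity.
Context {R : realType} {n : nat} (v m : 'I_n -> R) (c c1 : R).
Hypothesis v_gt0 : forall i, 0 < v i.
Hypothesis c_gt0 : 0 < c.
Hypothesis c1_gt0 : 0 < c1.

Definition shrink_coord (i : 'I_n) (x : n.-tuple R) : R :=
  tnth x i - c1 / (c + sqnorm (colv x)) * v i * tnth x i.

Lemma measurable_shrink_coord i : measurable_fun [set: _] (shrink_coord i).
Proof.
have mt := @measurable_tnth _ R n i.
apply: measurable_funB => //; apply: measurable_funM => //.
apply: measurable_funM => //; apply: measurable_funM => //.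
exact: measurable_inv_sqnorm.
Qed.

(** The cross term of the square is eliminated by Stein's identity.  The
    terms are arranged so that both sides are sums of nonnegative means. *)
Lemma coord_risk_identity i :
  (gmean v m (fun x => (shrink_coord i x - m i) ^+ 2)%R +
   (2 * c1 * v i ^+ 2)%:E * inv_moment v m c =
   (v i)%:E + (c1 * (c1 + 4) * v i ^+ 2)%:E * coord_moment v m c i)%E.
Proof.
have v0 := v_gt0 i.
have S0 := shift_sqnorm_gt0 c_gt0.
have mx := @measurable_tnth _ R n i.
have mS := @measurable_inv_sqnorm R n c.
have mL : measurable_fun [set: _] (fun x => (shrink_coord i x - m i) ^+ 2).
  by apply: measurable_funX; apply: measurable_funB => //;
    exact: measurable_shrink_coord.
pose A x := ((tnth x i - m i) ^+ 2 + tnth x i ^+ 2) * (c + sqnorm (colv x))^-1.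
have mA : measurable_fun [set: _] A.
  apply: measurable_funM => //.
  apply: measurable_funD; apply: measurable_funX => //.
  exact: measurable_funB.
have A0 x : 0 <= A x.
  by rewrite mulr_ge0 ?addr_ge0 ?sqr_ge0// invr_ge0 ltW.
pose B (x : n.-tuple R) := tnth x i ^+ 2 * (c + sqnorm (colv x)) ^- 2.
have mB : measurable_fun [set: _] B := measurable_coord_moment c i.
have B0 x : 0 <= B x by rewrite mulr_ge0 ?sqr_ge0// invr_ge0 sqr_ge0.
have C0 (x : n.-tuple R) : 0 <= (c + sqnorm (colv x))^-1.
  by rewrite invr_ge0 ltW.
have msq : measurable_fun [set: n.-tuple R] (fun x => (tnth x i - m i) ^+ 2).
  by apply: measurable_funX; exact: measurable_funB.
have int1 : (gmean v m (fun x => (shrink_coord i x - m i) ^+ 2)%R +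
    (v i * c1)%:E * gmean v m A =
    (v i)%:E + ((v i ^+ 2 * c1 ^+ 2)%:E * coord_moment v m c i +
    (v i * c1 * m i ^+ 2)%:E * inv_moment v m c))%E.
  have vc : 0 <= v i * c1 by rewrite mulr_ge0 ?ltW.
  have vc2 : 0 <= v i ^+ 2 * c1 ^+ 2 by rewrite mulr_ge0 ?sqr_ge0.
  have vcm : 0 <= v i * c1 * m i ^+ 2 by rewrite mulr_ge0 ?sqr_ge0.
  rewrite -gmeanZ// -gmeanD//; last 3 first.
  - exact: measurable_funM.
  - by move=> x; exact: sqr_ge0.
  - by move=> x; exact: mulr_ge0.
  rewrite -gmeanZ// -gmeanZ// -gmeanD//; last 4 first.
  - exact: measurable_funM.
  - exact: measurable_funM.
  - by move=> x; rewrite mulr_ge0 ?B0.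
  - by move=> x; rewrite mulr_ge0.
  have := gmean_sqr m v_gt0 i (m i); rewrite subrr expr0n addr0 => <-.
  rewrite -gmeanD//; last 3 first.
  - by apply: measurable_funD; exact: measurable_funM.
  - by move=> x; exact: sqr_ge0.
  - by move=> x; rewrite addr_ge0// mulr_ge0 ?B0.
  apply: eq_gmean => x; rewrite /A /shrink_coord.
  by field; rewrite gt_eqF.
have [C CE _] := fin_le (gmean_ge0 v m C0) (inv_moment_le m v_gt0 c_gt0).
have [Bi BE _] : exists2 s : R, coord_moment v m c i = s%:E & 0 <= s.
  apply: (@fin_le _ _ C); first exact: gmean_ge0.
  by rewrite -CE; exact: coord_moment_le.
have st := stein_identity m v_gt0 c_gt0 i.
move: int1 st; rewrite -[inv_moment v m c]/(gmean _ _ _) CE BE -/A.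
case: (gmean v m A) (gmean_ge0 v m A0) => [a| |]// _.
have L0 : (0 <= gmean v m (fun x => (shrink_coord i x - m i) ^+ 2)%R)%E.
  by apply: gmean_ge0 => x; exact: sqr_ge0.
case: (gmean v m _) L0 => [l| |]// _.
rewrite -!EFinM -!EFinD => -[e1] [e2]; congr EFin.
have : v i * c1 * (a + 4 * v i * Bi) = v i * c1 * ((m i ^+ 2 + 2 * v i) * C).
  by rewrite e2.
lra.
Qed.

End risk_identity.

(** * A moment inequality for centred Gaussian vectors *)

Section centered_comparison.
Context {R : realType} {n : nat} (v : 'I_n -> R) (c : R).
Hypothesis v_gt0 : forall i, 0 < v i.
Hypothesis c_gt0 : 0 < c.

Let den (i : 'I_n) (t : R) : R := 1 + 2 * t * v i.

Let den_gt0 i t : 0 <= t -> 0 < den i t.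
Proof. exact: tilt_den_gt0. Qed.

Let is_derive_den i (t : R) : is_derive t 1 (den i) (2 * v i).
Proof. by apply: is_derive_eq; rewrite /GRing.scale/=; ring. Qed.

(** exp(- t c) times the tilting factor, with the square roots written through
    logarithms so that it can be differentiated as a single exponential. *)
Let kappa (t : R) : R := expR (- (t * c) - (\sum_i ln (den i t)) / 2).

Let tilt_factorE (t : R) : 0 <= t ->
  expR (- (t * c)) * tilt_factor v (fun=> 0) t = kappa t.
Proof.
move=> t0; rewrite /kappa expRD; congr (_ * _).
rewrite mulr_suml -sumrN expR_sum; apply: eq_bigr => i _.
rewrite expr0n mulr0 mul0r oppr0 expR0 mulr1 -/(den i t).
rewrite -powR12_sqrt ?(ltW (den_gt0 i t0))// /powR gt_eqF ?den_gt0//.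
by rewrite -expRN mulrC.
Qed.

Let is_derive_sum_ln (t : R) : 0 <= t ->
  is_derive t 1 (fun t => \sum_i ln (den i t)) (\sum_i (2 * v i / den i t)).
Proof.
move=> t0.
rewrite (_ : (fun t => _) = \sum_i (fun t => ln (den i t))); last first.
  by apply/funext => s; rewrite fct_sumE.
apply: is_derive_sum => i.
have := is_derive1_ln (den_gt0 i t0) => dln.
have := is_derive_den i t => dd.
by apply: is_derive_eq; rewrite mulrC.
Qed.

Let is_derive_kappa (t : R) : 0 <= t ->
  is_derive t 1 kappa (- (c + \sum_i (v i / den i t)) * kappa t).
Proof.
move=> t0; have dL := is_derive_sum_ln t0.
apply: is_derive_eq; rewrite /GRing.scale/= -/(kappa t).
rewrite (_ : \sum_i (2 * v i / den i t) = 2 * \sum_i (v i / den i t));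
  last first.
  by rewrite mulr_sumr; apply: eq_bigr => i _; rewrite mulrA.
by rewrite /kappa; field.
Qed.

Let is_derive_sumV (t : R) : 0 <= t ->
  exists l, is_derive t 1 (fun t => \sum_i (v i / den i t)) l.
Proof.
move=> t0; exists (\sum_i (v i * (- (den i t) ^- 2 *: (2 * v i)))).
rewrite (_ : (fun t => _) = \sum_i (fun t => v i / den i t)); last first.
  by apply/funext => s; rewrite fct_sumE.
apply: is_derive_sum => i.
have dd := is_derive_den i t.
have dV := is_deriveV (lt0r_neq0 (den_gt0 i t0)) dd.
by apply: is_derive_eq; rewrite /GRing.scale/=; ring.
Qed.

(** For equal variances and c1 = 2 (n - 2) this becomes an equality in the limit
    c -> 0.  In general let r_j = 1 + 2 t v_j and r_0 = 1 + 2 t v0.  With kappa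
    the Laplace kernel, the two sides are the integrals over t >= 0 of
    (c1 + 4) t (v_i / r_i) kappa and of 2 kappa, and the second integrand minus
    the first is (2 - c1 v_i t) kappa / r_i.  This dominates the derivative of
    2 t (r_0 / r_i) kappa, since r_0 v_j / r_j >= v0 for every j: the extra
    factor r_0 / r_i is what makes the smallest variance v0 enter in place of
    the individual ones. *)
Lemma coord_moment_le_inv_moment (v0 c1 : R) (i : 'I_n) :
  0 < v0 -> (forall j, v0 <= v j) -> 0 < c1 ->
  c1 * v i <= 2 * (n%:R - 2) * (v0 + c / n%:R) ->
  ((c1 + 4)%:E * coord_moment v (fun=> 0%R) c i <=
   2%:E * inv_moment v (fun=> 0%R) c)%E.
Proof.
move=> v0_gt0 v0_le c1_gt0 hc1.
rewrite (inv_moment_laplace _ v_gt0 c_gt0 i).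
rewrite (coord_moment_laplace _ v_gt0 c_gt0).
pose r0 (t : R) : R := 1 + 2 * t * v0.
have dr0 (t : R) : is_derive t 1 r0 (2 * v0).
  by apply: is_derive_eq; rewrite /GRing.scale/=; ring.
pose f t := (c1 + 4) * (t * (v i / den i t) * kappa t).
pose g t := 2 * kappa t.
pose T t := 2 * (t * r0 t * (den i t)^-1 * kappa t).
pose T' t := 2 * ((den i t)^-1 * kappa t * (1 + 4 * t * v0 -
  t * r0 t * (c + 2 * v i / den i t + \sum_j (v j / den j t)))).
have c14 : 0 <= c1 + 4 by rewrite addr_ge0// ltW.
have kappa_gt0 t : 0 < kappa t by exact: expR_gt0.
have mk : measurable_fun (`[0, +oo[%classic : set R)
    (fun t => expR (- (t * c)) * tilt_factor v (fun=> 0) t).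
  apply: measurable_funM; first exact: measurable_expRNM.
  exact: measurable_tilt_factor.
rewrite -ge0_integralZl//=; last 2 first.
- apply/measurable_EFinP; apply: measurable_funM.
    apply: measurable_funM; last exact: measurable_tilt_factor.
    by apply: measurable_funM => //; exact: measurable_expRNM.
  apply: measurable_funD; first exact: measurable_tilt_var.
  by apply: measurable_funX; exact: measurable_tilt_mean.
- move=> t; rewrite in_itv/= andbT => t0.
  rewrite lee_fin !mulr_ge0 ?expR_ge0 ?tilt_factor_ge0//.
  by rewrite addr_ge0 ?sqr_ge0// ltW// tilt_var_gt0.
rewrite -ge0_integralZl//=; last 2 first.
- exact/measurable_EFinP.
- by move=> t _; rewrite lee_fin mulr_ge0 ?expR_ge0 ?tilt_factor_ge0.
have fE : {in `[0%R, +oo[%classic, (fun t => ((c1 + 4)%:E *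
    (t * expR (- (t * c)) * tilt_factor v (fun=> 0) t *
     (tilt_var v t i + tilt_mean v (fun=> 0) t i ^+ 2))%:E)%E) =1 EFin \o f}.
  move=> t; rewrite inE/= in_itv/= andbT => t0.
  rewrite -EFinM -(mulrA t) tilt_factorE// /f /tilt_var /tilt_mean mul0r.
  by rewrite expr0n addr0 -/(den i t); congr EFin; ring.
have gE : {in `[0%R, +oo[%classic, (fun t => (2%:E *
    (expR (- (t * c)) * tilt_factor v (fun=> 0) t)%:E)%E) =1 EFin \o g}.
  by move=> t; rewrite inE/= in_itv/= andbT => t0; rewrite -EFinM tilt_factorE.
apply: (@le_trans _ _ (\int[lebesgue_measure]_(t in `[0%R, +oo[) (f t)%:E)%E).
  rewrite le_eqVlt; apply/orP; left; apply/eqP.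
  by apply: eq_integral => t; exact: fE.
apply: (@le_trans _ _ (\int[lebesgue_measure]_(t in `[0%R, +oo[) (g t)%:E)%E);
  last first.
  rewrite le_eqVlt; apply/orP; left; apply/eqP/esym.
  by apply: eq_integral => t; exact: gE.
apply: (@integral_le_of_derive0y R f g T T').
  move=> t t0; rewrite /T !mul0r mulr0.
  rewrite !mulr_ge0 ?invr_ge0 ?(ltW (kappa_gt0 t))//.
    by rewrite addr_ge0// !mulr_ge0// ltW.
  by rewrite ltW ?den_gt0.
move=> t t0.
have d_gt0 := den_gt0 i t0.
have dd := is_derive_den i t.
have dV := is_deriveV (lt0r_neq0 d_gt0) dd.
have dk := is_derive_kappa t0.
have [l dl] := is_derive_sumV t0.
split; split.
- by rewrite /f !mulr_ge0 ?invr_ge0// ltW.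
- by rewrite /g mulr_ge0// ltW.
- have r0_gt0 : 0 < r0 t by rewrite ltr_wpDr// mulr_ge0 ?mulr_ge0// ltW.
  have r0V j : v0 <= r0 t * (v j / den j t).
    rewrite mulrA ler_pdivlMr ?den_gt0// /r0 /den.
    by rewrite -subr_ge0 (_ : _ - _ = v j - v0) ?subr_ge0//; ring.
  have r0S : n%:R * v0 <= r0 t * \sum_j (v j / den j t).
    rewrite mulr_sumr mulr_natl -[n in v0 *+ n]card_ord -sumr_const.
    by apply: ler_sum => j _; exact: r0V.
  have n_gt0 : 0 < n%:R :> R by rewrite ltr0n (leq_ltn_trans _ (ltn_ord i)).
  have -> : g t - f t =
      (den i t)^-1 * kappa t * (2 - c1 * v i * t).
    by rewrite /f /g; rewrite /den in d_gt0 *; field; rewrite gt_eqF.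
  rewrite /T' mulrCA ler_wpM2l ?mulr_ge0 ?invr_ge0 ?(ltW d_gt0)
    ?(ltW (kappa_gt0 t))//.
  (* what is left over is at least 4 t c / n + 4 c v0 t^2 *)
  have cn : c / n%:R * n%:R = c by rewrite divfK// gt_eqF.
  have cn0 : 0 < c / n%:R by rewrite divr_gt0.
  have := ler_wpM2r t0 hc1; have := ler_wpM2l t0 r0S.
  have := ler_wpM2l t0 (r0V i); have : 0 <= c * v0 * t ^+ 2.
    by rewrite !mulr_ge0 ?sqr_ge0 ?(ltW c_gt0) ?(ltW v0_gt0).
  rewrite /r0; set S := \sum_j _; set y := v i / den i t.
  rewrite (_ : 2 * v i / den i t = 2 * y); last by rewrite mulrA.
  move: cn cn0; set e := c / n%:R => cn cn0.
  have := mulr_ge0 t0 (ltW cn0).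
  rewrite -cn; lra.
- apply: derivable_continuous; apply: is_derive_eq; reflexivity.
- apply: derivable_continuous; apply: is_derive_eq; reflexivity.
- apply: derivable_continuous; apply: is_derive_eq; reflexivity.
- apply: is_derive_eq; rewrite /GRing.scale/=.
  rewrite /T' /r0; set S := \sum_j _; set k := kappa t; set d := den i t.
  by field; rewrite gt_eqF.
Qed.

End centered_comparison.

(** * Bayes risks under a centred Gaussian prior *)

Definition bayes_mean (R : realType) (n : nat) (tau : R)
    (F : n.-tuple R -> \bar R) : \bar R :=
  (\int[lebesgue_tuple R n]_theta
    (F theta * (gaussn (fun=> tau) (fun=> 0%R) theta)%:E))%E.

Section bayes_mean.
Context {R : realType} {n : nat}.

Lemma bayes_meanD (tau : R) (F G : n.-tuple R -> \bar R) :
  measurable_fun [set: _] F -> measurable_fun [set: _] G ->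
  (forall x, (0 <= F x)%E) -> (forall x, (0 <= G x)%E) ->
  (bayes_mean tau (fun x => F x + G x) =
   bayes_mean tau F + bayes_mean tau G)%E.
Proof.
move=> mF mG F0 G0.
have mg : measurable_fun [set: n.-tuple R]
    (fun theta => (gaussn (fun=> tau) (fun=> 0) theta)%:E).
  by apply/measurable_EFinP; exact: measurable_gaussn.
rewrite /bayes_mean -ge0_integralD.
- by apply: eq_integral => theta _; rewrite ge0_muleDl.
- exact: measurableT.
- by move=> theta _; rewrite mule_ge0// lee_fin gaussn_ge0.
- exact: emeasurable_funM mF mg.
- by move=> theta _; rewrite mule_ge0// lee_fin gaussn_ge0.
- exact: emeasurable_funM mG mg.
Qed.

Lemma bayes_meanZ (tau a : R) (F : n.-tuple R -> \bar R) :
  measurable_fun [set: _] F -> (forall x, (0 <= F x)%E) -> 0 <= a ->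
  (bayes_mean tau (fun x => a%:E * F x) = a%:E * bayes_mean tau F)%E.
Proof.
move=> mF F0 a0.
have mg : measurable_fun [set: n.-tuple R]
    (fun theta => (gaussn (fun=> tau) (fun=> 0) theta)%:E).
  by apply/measurable_EFinP; exact: measurable_gaussn.
rewrite /bayes_mean -ge0_integralZl.
- by apply: eq_integral => theta _; rewrite muleA.
- exact: measurableT.
- exact: emeasurable_funM mF mg.
- by move=> theta _; rewrite mule_ge0// lee_fin gaussn_ge0.
- by rewrite lee_fin.
Qed.

Lemma bayes_mean_cst (tau a : R) : 0 < tau -> 0 <= a ->
  bayes_mean (n := n) tau (fun=> a%:E) = a%:E.
Proof.
move=> t0 a0; rewrite -[RHS](@gmean_cst _ n (fun=> tau) (fun=> 0))//.
Qed.

End bayes_mean.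

Section prior.
Context {R : realType} {n : nat} (s : 'I_n -> R).
Hypothesis s_gt0 : forall i, 0 < s i.
Implicit Types f : n.-tuple R -> n.-tuple R -> R.

Lemma measurable_gaussn_mean : measurable_fun [set: n.-tuple R * n.-tuple R]
  (fun z => gaussn s (tnth z.1) z.2).
Proof.
apply: measurable_prod => i _; apply: measurable_funM => //.
apply: measurableT_comp => //; apply: measurableT_comp => //.
apply: measurable_funM => //; apply: measurable_funX.
by apply: measurable_funB; exact: measurable_tnth_comp.
Qed.

Lemma measurable_gmean_mean f :
  measurable_fun [set: n.-tuple R * n.-tuple R] (fun z => f z.1 z.2) ->
  (forall theta x, 0 <= f theta x) ->
  measurable_fun [set: n.-tuple R]
    (fun theta => gmean s (tnth theta) (f theta)).
Proof.
move=> mf f0.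
apply: (@measurable_fun_fubini_tonelli_F _ _ _ _ _ (lebesgue_tuple R n)
  (fun z => (f z.1 z.2 * gaussn s (tnth z.1) z.2)%:E)).
- apply/measurable_EFinP; apply: measurable_funM => //.
  exact: measurable_gaussn_mean.
- by move=> z; rewrite lee_fin mulr_ge0 ?gaussn_ge0.
Qed.

Context (tau : R).
Hypothesis tau_gt0 : 0 < tau.

Definition post_var i : R := s i * tau / (s i + tau).

Definition post_mean (x : n.-tuple R) i : R := tau / (s i + tau) * tnth x i.

Lemma post_var_gt0 i : 0 < post_var i.
Proof. by rewrite divr_gt0 ?mulr_gt0 ?addr_gt0. Qed.

(** Averaging the mean given theta over the prior is the same as averaging the
    posterior mean over the marginal law of X. *)
Lemma bayes_mean_gmean f :
  measurable_fun [set: n.-tuple R * n.-tuple R] (fun z => f z.1 z.2) ->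
  (forall theta x, 0 <= f theta x) ->
  (bayes_mean tau (fun theta => gmean s (tnth theta) (f theta)) =
   \int[lebesgue_tuple R n]_x
     (gmean post_var (post_mean x) (f ^~ x) *
      (gaussn (fun i => s i + tau)%R (fun=> 0%R) x)%:E))%E.
Proof.
move=> mf f0.
have gE theta x : gaussn s (tnth theta) x * gaussn (fun=> tau) (fun=> 0) theta =
    gaussn (fun i => s i + tau) (fun=> 0) x *
    gaussn post_var (post_mean x) theta.
  rewrite /gaussn -!big_split/=; apply: eq_bigr => i _.
  by rewrite gaussM_gauss.
pose F (z : n.-tuple R * n.-tuple R) : \bar R :=
  (f z.1 z.2 * gaussn s (tnth z.1) z.2 * gaussn (fun=> tau) (fun=> 0) z.1)%:E.
transitivity (\int[lebesgue_tuple R n]_theta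
    \int[lebesgue_tuple R n]_x F (theta, x))%E.
  apply: eq_integral => theta _; rewrite muleC /gmean -ge0_integralZl//=.
  - by apply: eq_integral => x _; rewrite -EFinM /F mulrC.
  - apply: measurable_mul_gaussn; exact: (measurable_fun_pair2 _ mf).
  - by move=> x _; rewrite lee_fin mulr_ge0 ?gaussn_ge0.
  - by rewrite lee_fin gaussn_ge0.
rewrite fubini_tonelli; last 2 first.
- apply/measurable_EFinP; apply: measurable_funM.
    by apply: measurable_funM => //; exact: measurable_gaussn_mean.
  exact: (measurableT_comp (measurable_gaussn (fun=> tau) (fun=> 0))).
- by move=> z; rewrite lee_fin !mulr_ge0 ?gaussn_ge0.
apply: eq_integral => x _; rewrite muleC /gmean -ge0_integralZl//=.
- apply: eq_integral => theta _; rewrite -EFinM /F/=; congr EFin.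
  by rewrite -mulrA gE; ring.
- apply: measurable_mul_gaussn; exact: (measurable_fun_pair1 _ mf).
- by move=> theta _; rewrite lee_fin mulr_ge0 ?gaussn_ge0.
- by rewrite lee_fin gaussn_ge0.
Qed.

(** For a function of X alone only the marginal law N(0, s_i + tau) matters. *)
Lemma bayes_mean_cst_mean (g : n.-tuple R -> R) :
  measurable_fun [set: _] g -> (forall x, 0 <= g x) ->
  bayes_mean tau (fun theta => gmean s (tnth theta) g) =
  gmean (fun i => s i + tau) (fun=> 0) g.
Proof.
move=> mg g0; rewrite (@bayes_mean_gmean (fun _ x => g x))//.
- apply: eq_integral => x _; rewrite gmean_cst//.
  by move=> i; exact: post_var_gt0.
- exact: (measurableT_comp mg).
Qed.

(** The posterior expected loss of delta when x is observed. *)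
Definition post_risk (delta : n.-tuple R -> n.-tuple R) (x : n.-tuple R) : R :=
  \sum_i (post_var i + (tnth (delta x) i - post_mean x i) ^+ 2).

Lemma post_risk_ge0 delta x : 0 <= post_risk delta x.
Proof.
by apply: sumr_ge0 => i _; rewrite addr_ge0 ?sqr_ge0// ltW ?post_var_gt0.
Qed.

Lemma measurable_post_risk delta : estimator delta ->
  measurable_fun [set: _] (post_risk delta).
Proof.
move=> md; apply: measurable_sum => i; apply: measurable_funD => //.
apply: measurable_funX; apply: measurable_funB.
  exact: measurable_tnth_comp.
by apply: measurable_funM => //; exact: measurable_tnth.
Qed.

Lemma bayes_risk_post (delta : n.-tuple R -> n.-tuple R) : estimator delta ->
  (bayes_mean tau (fun theta => gmean s (tnth theta)
     (fun x => sqnorm (colv (delta x) - colv theta))) =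
   gmean (fun i => s i + tau)%R (fun=> 0%R) (post_risk delta))%E.
Proof.
move=> md.
rewrite (@bayes_mean_gmean (fun theta x =>
  sqnorm (colv (delta x) - colv theta))).
- apply: eq_integral => x _; rewrite EFinM; congr (_ * _)%E.
  rewrite (eq_gmean _ _ (g := fun theta => \sum_i
    (tnth theta i - tnth (delta x) i) ^+ 2)); last first.
    move=> theta; rewrite sqnormB_colv; apply: eq_bigr => i _.
    by rewrite -sqrrN opprB.
  rewrite (@gmean_sum _ _ _ _ _ _ (fun i (theta : n.-tuple R) =>
    (tnth theta i - tnth (delta x) i) ^+ 2)).
  - rewrite /post_risk -sumEFin; apply: eq_bigr => i _.
    by rewrite gmean_sqr//; exact: post_var_gt0.
  - move=> i; apply: measurable_funX; apply: measurable_funB => //.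
    exact: measurable_tnth.
  - by move=> i theta; exact: sqr_ge0.
- apply: measurable_sqnormB => //.
  exact: (measurableT_comp md).
- by move=> theta x; exact: sqnorm_ge0.
Qed.

Lemma bayes_risk_ge delta : estimator delta ->
  ((\sum_i post_var i)%:E <= bayes_mean tau (fun theta => gmean s (tnth theta)
     (fun x => sqnorm (colv (delta x) - colv theta))))%E.
Proof.
move=> md; rewrite bayes_risk_post//.
rewrite -(@gmean_cst _ _ (fun i => s i + tau) (fun=> 0)); last 2 first.
- by move=> i; rewrite addr_gt0.
- by apply: sumr_ge0 => i _; rewrite ltW ?post_var_gt0.
apply: gmean_le => //.
- exact: measurable_post_risk.
- by move=> _; apply: sumr_ge0 => i _; rewrite ltW ?post_var_gt0.
- by move=> x; apply: ler_sum => i _; rewrite lerDl sqr_ge0.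
Qed.

End prior.

(** * The trace of the covariance bounds every maximal risk from below *)

Section minimax_bounds.
Context {R : realType} {n : nat} (sigma : 'I_n -> R).
Hypothesis s_gt0 : forall i, 0 < sigma i ^+ 2.
Let s (i : 'I_n) : R := sigma i ^+ 2.
Implicit Types delta : n.-tuple R -> n.-tuple R.

Lemma risk_gmean delta theta : estimator delta ->
  risk (diag_cov sigma) delta theta =
  gmean s (tnth theta) (fun x => sqnorm (colv (delta x) - colv theta)).
Proof.
move=> mdelta; rewrite /risk.
rewrite (@ge0_integral_density _ _ _ (lebesgue_tuple R n) _
  (mvnormal_pdf theta (diag_cov sigma))).
- by apply: eq_integral => x _; rewrite -EFinM mvnormal_pdf_diag.
- exact: measurable_mvnormal_pdf.
- exact: mvnormal_pdf_ge0.
- by [].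
- by apply/measurable_EFinP; exact: measurable_sqnormB.
- by move=> x; rewrite lee_fin sumr_ge0// => i _; rewrite sqr_ge0.
Qed.

Lemma ensemble_riskE delta tau : 0 < tau -> estimator delta ->
  ensemble_risk (diag_cov sigma) delta tau =
  bayes_mean tau (risk (diag_cov sigma) delta).
Proof.
by move=> t0 md; apply: eq_integral => theta _; rewrite prior_gaussn.
Qed.

Lemma measurable_risk delta : estimator delta ->
  measurable_fun [set: _] (risk (diag_cov sigma) delta).
Proof.
move=> md; rewrite (_ : risk _ _ = fun theta => gmean s (tnth theta)
    (fun x => sqnorm (colv (delta x) - colv theta))); last first.
  by apply/funext => theta; rewrite risk_gmean.
apply: (measurable_gmean_mean s
  (f := fun theta x => sqnorm (colv (delta x) - colv theta))).
- apply: measurable_sqnormB => //.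
  exact: (measurableT_comp md).
- by move=> theta x; exact: sqnorm_ge0.
Qed.

Lemma risk_ge0 delta theta : (0 <= risk (diag_cov sigma) delta theta)%E.
Proof. by apply: integral_ge0 => x _; rewrite lee_fin sqnorm_ge0. Qed.

Lemma max_ensemble_risk_le delta : estimator delta ->
  (max_ensemble_risk (diag_cov sigma) delta <=
   max_risk (diag_cov sigma) delta)%E.
Proof.
move=> md; apply: ge_ereal_sup => _ [tau + <-]; rewrite /= in_itv/= andbT => t0.
rewrite ensemble_riskE//.
have M0 : (0 <= max_risk (diag_cov sigma) delta)%E.
  apply: (@le_trans _ _ (risk (diag_cov sigma) delta [tuple 0 | i < n])).
    exact: risk_ge0.
  by apply: ereal_sup_ubound; exists [tuple 0 | i < n].
have mg := measurable_gaussn (fun=> tau) (fun=> 0 : R) (n := n).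
apply: (@le_trans _ _ (bayes_mean tau
    (fun=> max_risk (diag_cov sigma) delta))).
  apply: ge0_le_integral => //.
  - by move=> theta _; rewrite mule_ge0 ?risk_ge0 ?lee_fin ?gaussn_ge0.
  - by apply: emeasurable_funM; [exact: measurable_risk|exact/measurable_EFinP].
  - by apply: emeasurable_funM => //; exact/measurable_EFinP.
  - move=> theta _; rewrite lee_wpmul2r ?lee_fin ?gaussn_ge0//.
    by apply: ereal_sup_ubound; exists theta.
rewrite /bayes_mean ge0_integralZl//=.
- by rewrite integral_gaussn// mule1.
- exact/measurable_EFinP.
- by move=> theta _; rewrite lee_fin gaussn_ge0.
Qed.

(** Each posterior variance s_i tau / (s_i + tau) falls short of s_i by at most
    s_i^2 / tau, so the Bayes risks come arbitrarily close to the trace. *)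
Lemma max_ensemble_risk_ge delta : estimator delta ->
  ((\sum_i s i)%:E <= max_ensemble_risk (diag_cov sigma) delta)%E.
Proof.
move=> md.
have lb tau : 0 < tau -> ((\sum_i post_var s tau i)%:E <=
    max_ensemble_risk (diag_cov sigma) delta)%E.
  move=> t0; apply: (@le_trans _ _ (ensemble_risk (diag_cov sigma) delta tau)).
    rewrite ensemble_riskE//.
    have := bayes_risk_ge s_gt0 t0 md.
    move=> /le_trans; apply; rewrite le_eqVlt; apply/orP; left; apply/eqP.
    by apply: eq_integral => theta _; rewrite risk_gmean.
  by apply: ereal_sup_ubound; exists tau => //=; rewrite in_itv/= t0.
case: (max_ensemble_risk _ _) lb => [r| |] lb; last 2 first.
- by rewrite leey.
- by have := lb 1 ltr01.
rewrite lee_fin; apply/ler_addgt0Pr => e e0.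
pose K := \sum_i s i ^+ 2.
have K0 : 0 <= K by apply: sumr_ge0 => i _; exact: sqr_ge0.
(* K + 1 rather than K keeps tau positive without discussing K = 0 *)
pose tau := (K + 1) / e.
have t0 : 0 < tau by rewrite divr_gt0 ?ltr_wpDl.
have := lb tau t0; rewrite lee_fin => lbr.
have : \sum_i s i <= \sum_i (post_var s tau i + s i ^+ 2 / tau).
  apply: ler_sum => i _; rewrite /post_var.
  have si : 0 < s i := s_gt0 i.
  have st : 0 < s i + tau by rewrite addr_gt0.
  rewrite -lerBlDl (_ : s i - _ = s i ^+ 2 / (s i + tau)); last first.
    by field; rewrite gt_eqF.
  by rewrite ler_wpM2l ?sqr_ge0// lef_pV2 ?posrE// lerDr ltW.
rewrite big_split/= -mulr_suml -/K.
have : K / tau <= e.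
  rewrite /tau invf_div mulrCA ler_piMr ?(ltW e0)// ler_pdivrMr ?ltr_wpDl//.
  by rewrite mul1r lerDl.
lra.
Qed.

End minimax_bounds.

(** * Risk bounds for shrinkage estimators with c > 0 *)

Definition shrink (R : realType) (n : nat) (v : 'I_n -> R) (c c1 : R)
    (x : n.-tuple R) : n.-tuple R :=
  [tuple shrink_coord v c c1 i x | i < n].

Lemma shrinkageE (R : realType) (n : nat) (sigma : 'I_n.+1 -> R) (c1 c2 : R) :
  shrinkage sigma c1 c2 =
  shrink (fun i => sigma i ^+ 2) (c2 * sigma ord0 ^+ 2) c1.
Proof.
apply/funext => x; apply: eq_from_tnth => i; rewrite !tnth_mktuple.
rewrite mulmxBl mul1mx -scalemxAl mul_diag_mx !mxE /shrink_coord.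
by rewrite mulrA.
Qed.

Section shrink.
Context {R : realType} {n : nat} (sigma : 'I_n -> R) (c1 : R).
Hypothesis s_gt0 : forall i, 0 < sigma i ^+ 2.
Hypothesis c1_gt0 : 0 < c1.
Let s (i : 'I_n) : R := sigma i ^+ 2.

Lemma estimator_shrink c : estimator (shrink s c c1).
Proof.
apply/measurable_fun_tnthP => i.
rewrite (_ : _ \o _ = shrink_coord s c c1 i); last first.
  by apply/funext => x /=; rewrite tnth_mktuple.
exact: measurable_shrink_coord.
Qed.

Lemma risk_shrink c theta :
  risk (diag_cov sigma) (shrink s c c1) theta =
  (\sum_i gmean s (tnth theta)
    (fun x => (shrink_coord s c c1 i x - tnth theta i) ^+ 2)%R)%E.
Proof.
rewrite risk_gmean//; last exact: estimator_shrink.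
rewrite -(@gmean_sum _ _ _ _ _ _ (fun i x =>
  (shrink_coord s c c1 i x - tnth theta i) ^+ 2)).
- apply: eq_gmean => x; rewrite sqnormB_colv.
  by apply: eq_bigr => i _; rewrite tnth_mktuple.
- move=> i; apply: measurable_funX; apply: measurable_funB => //.
  exact: measurable_shrink_coord.
- by move=> i x; exact: sqr_ge0.
Qed.

Lemma sum_coord_moment_le (v m : 'I_n -> R) c : 0 < c ->
  (\sum_i coord_moment v m c i <= inv_moment v m c)%E.
Proof.
move=> c0; rewrite /coord_moment -(@gmean_sum _ _ _ _ _ _ (fun i x =>
  tnth x i ^+ 2 * (c + sqnorm (colv x)) ^- 2)); last 2 first.
- by move=> i; exact: measurable_coord_moment.
- by move=> i x; rewrite mulr_ge0 ?sqr_ge0// invr_ge0 sqr_ge0.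
apply: gmean_le.
- by apply: measurable_sum => i; exact: measurable_coord_moment.
- exact: measurable_inv_sqnorm.
- move=> x; apply: sumr_ge0 => i _.
  by rewrite mulr_ge0 ?sqr_ge0// invr_ge0 sqr_ge0.
- move=> x; have S0 := shift_sqnorm_gt0 c0 x.
  rewrite -mulr_suml -sqnorm_colv expr2 invfM mulrA.
  rewrite ler_piMl ?invr_ge0 ?(ltW S0)// ler_pdivrMr// mul1r.
  by rewrite lerDr ltW.
Qed.

(** Sum the coordinate identity: its positive terms are at most
    c1 (c1 + 4) smax^2 E[1 / (c + S)], where S = |X|^2, while the negative ones
    are 2 c1 E[1 / (c + S)] times the sum of the s_i^2. *)
Lemma risk_shrink_le (c smax : R) theta : 0 < c -> (forall i, s i <= smax) ->
  (c1 + 4) * smax ^+ 2 <= 2 * \sum_i s i ^+ 2 ->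
  (risk (diag_cov sigma) (shrink s c c1) theta <= (\sum_i s i)%:E)%E.
Proof.
move=> c0 smax_ge hc1; set m := tnth theta.
have [C CE C_ge0] : exists2 C : R, inv_moment s m c = C%:E & 0 <= C.
  apply: (@fin_le _ _ c^-1); last exact: inv_moment_le.
  by apply: gmean_ge0 => x; rewrite invr_ge0 ltW// shift_sqnorm_gt0.
have /choice [B BP] i : exists B : R, coord_moment s m c i = B%:E /\ 0 <= B.
  have [] := @fin_le _ (coord_moment s m c i) C.
  - by apply: gmean_ge0 => x; rewrite mulr_ge0 ?sqr_ge0// invr_ge0 sqr_ge0.
  - by rewrite -CE; exact: coord_moment_le.
  - by move=> b ? ?; exists b.
have BC : \sum_i B i <= C.
  have := sum_coord_moment_le s m c0; rewrite CE.
  by under eq_bigr do rewrite (BP _).1; rewrite sumEFin lee_fin.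
have LE i : gmean s m (fun x => (shrink_coord s c c1 i x - m i) ^+ 2) =
   (s i + c1 * ((c1 + 4) * s i ^+ 2 * B i - 2 * s i ^+ 2 * C))%:E.
  have := coord_risk_identity m s_gt0 c0 c1_gt0 i.
  rewrite CE (BP i).1; case: (gmean _ _ _) => [l| |]//.
  rewrite -!EFinM -!EFinD => -[e]; congr EFin.
  by move: e; rewrite /s; lra.
rewrite risk_shrink; under eq_bigr do rewrite LE.
rewrite sumEFin lee_fin big_split/= gerDl -mulr_sumr pmulr_rle0//.
rewrite sumrB subr_le0.
have -> : \sum_i 2 * s i ^+ 2 * C = (2 * \sum_i s i ^+ 2) * C.
  by rewrite mulr_sumr mulr_suml.
apply: (@le_trans _ _ ((c1 + 4) * smax ^+ 2 * C)); last by rewrite ler_wpM2r.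
apply: (@le_trans _ _ ((c1 + 4) * smax ^+ 2 * \sum_i B i)); last first.
  by rewrite ler_wpM2l// mulr_ge0 ?sqr_ge0// addr_ge0// ltW.
rewrite mulr_sumr; apply: ler_sum => i _; rewrite ler_wpM2r ?(BP i).2//.
rewrite ler_wpM2l ?addr_ge0 ?(ltW c1_gt0)//.
by rewrite lerXn2r ?nnegrE ?sqr_ge0// (le_trans _ (smax_ge i))// sqr_ge0.
Qed.

(** Here the bound holds for each coordinate: the averaged identity involves the
    centred law with variances s_i + tau, to which the moment inequality applies
    with smallest variance smin + tau. *)
Lemma ensemble_risk_shrink_le (c smin tau : R) :
  0 < c -> 0 < tau -> 0 < smin -> (forall i, smin <= s i) ->
  (forall i, c1 * (s i + tau) <= 2 * (n%:R - 2) * (smin + tau + c / n%:R)) ->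
  (ensemble_risk (diag_cov sigma) (shrink s c c1) tau <= (\sum_i s i)%:E)%E.
Proof.
move=> c0 t0 smin0 smin_le hc1.
rewrite ensemble_riskE//; last exact: estimator_shrink.
pose L i theta := gmean s (tnth theta)
  (fun x => (shrink_coord s c c1 i x - tnth theta i) ^+ 2).
have L0 i theta : (0 <= L i theta)%E.
  by apply: gmean_ge0 => x; exact: sqr_ge0.
have mL i : measurable_fun [set: _] (L i).
  apply: (measurable_gmean_mean s (f := fun theta x =>
    (shrink_coord s c c1 i x - tnth theta i) ^+ 2)).
  - apply: measurable_funX; apply: measurable_funB.
      exact: (measurableT_comp (measurable_shrink_coord s c c1 i)).
    exact: measurable_tnth_comp.
  - by move=> theta x; exact: sqr_ge0.
have mg : measurable_fun [set: n.-tuple R]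
    (fun theta => (gaussn (fun=> tau) (fun=> 0) theta)%:E).
  by apply/measurable_EFinP; exact: measurable_gaussn.
have -> : bayes_mean tau (risk (diag_cov sigma) (shrink s c c1)) =
    (\sum_i bayes_mean tau (L i))%E.
  rewrite /bayes_mean -ge0_integral_sum//.
  - apply: eq_integral => theta _; rewrite risk_shrink.
    by rewrite ge0_sume_distrl// => i _; exact: L0.
  - by move=> i; exact: emeasurable_funM.
  - by move=> i theta _; rewrite mule_ge0// lee_fin gaussn_ge0.
rewrite -sumEFin; apply: lee_sum => i _.
have v0 j : 0 < s j + tau by rewrite addr_gt0// s_gt0.
have C0 (x : n.-tuple R) : 0 <= (c + sqnorm (colv x))^-1.
  by rewrite invr_ge0 ltW// shift_sqnorm_gt0.
have B0 (x : n.-tuple R) : 0 <= tnth x i ^+ 2 * (c + sqnorm (colv x)) ^- 2.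
  by rewrite mulr_ge0 ?sqr_ge0// invr_ge0 sqr_ge0.
have mC := @measurable_inv_sqnorm R n c.
have mB := @measurable_coord_moment R n c i.
have CE : bayes_mean tau (fun theta => inv_moment s (tnth theta) c) =
    inv_moment (fun j => s j + tau) (fun=> 0) c :=
  bayes_mean_cst_mean s_gt0 t0 mC C0.
have BE : bayes_mean tau (fun theta => coord_moment s (tnth theta) c i) =
    coord_moment (fun j => s j + tau) (fun=> 0) c i :=
  bayes_mean_cst_mean s_gt0 t0 mB B0.
have mCt : measurable_fun [set: _] (fun theta => inv_moment s (tnth theta) c).
  apply: (measurable_gmean_mean s (f := fun _ x =>
    (c + sqnorm (colv x))^-1)) => //.
  exact: (measurableT_comp mC).
have mBt : measurable_fun [set: _]
    (fun theta => coord_moment s (tnth theta) c i).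
  apply: (measurable_gmean_mean s (f := fun _ x =>
    tnth x i ^+ 2 * (c + sqnorm (colv x)) ^- 2)) => //.
  exact: (measurableT_comp mB).
have Ct0 theta : (0 <= inv_moment s (tnth theta) c)%E by exact: gmean_ge0.
have Bt0 theta : (0 <= coord_moment s (tnth theta) c i)%E by exact: gmean_ge0.
have g0 (theta : n.-tuple R) :
    (0 <= (gaussn (fun=> tau) (fun=> 0) theta)%:E)%E.
  by rewrite lee_fin gaussn_ge0.
have a0 : 0 <= 2 * c1 * s i ^+ 2 by rewrite mulr_ge0 ?sqr_ge0// mulr_ge0// ltW.
have b0 : 0 <= c1 * (c1 + 4) * s i ^+ 2.
  rewrite mulr_ge0 ?sqr_ge0// mulr_ge0 ?(ltW c1_gt0)//.
  by rewrite addr_ge0 ?(ltW c1_gt0).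
have si0 : 0 <= s i by exact: sqr_ge0.
have E : (bayes_mean tau (L i) + (2 * c1 * s i ^+ 2)%:E *
      inv_moment (fun j => s j + tau)%R (fun=> 0%R) c =
    (s i)%:E + (c1 * (c1 + 4) * s i ^+ 2)%:E *
      coord_moment (fun j => s j + tau)%R (fun=> 0%R) c i)%E.
  rewrite -CE -BE -(bayes_mean_cst (n := n) t0 si0).
  rewrite -(bayes_meanZ tau mBt Bt0 b0) -(bayes_meanZ tau mCt Ct0 a0).
  have aC0 theta :
      (0 <= (2 * c1 * s i ^+ 2)%:E * inv_moment s (tnth theta) c)%E.
    by rewrite mule_ge0 ?lee_fin.
  have bB0 theta :
      (0 <= (c1 * (c1 + 4) * s i ^+ 2)%:E * coord_moment s (tnth theta) c i)%E.
    by rewrite mule_ge0 ?lee_fin.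
  have sE0 (theta : n.-tuple R) : (0 <= (s i)%:E)%E by rewrite lee_fin.
  apply: etrans (esym (bayes_meanD tau (mL i) (measurable_funeM _ mCt)
    (L0 i) aC0)) _.
  apply: etrans _ (bayes_meanD tau (measurable_cst _) (measurable_funeM _ mBt)
    sE0 bB0).
  apply: eq_integral => theta _; congr (_ * _)%E.
  exact: coord_risk_identity.
have [C CE' C_ge0] := fin_le (gmean_ge0 (fun j => s j + tau) (fun=> 0) C0)
  (inv_moment_le (fun=> 0) v0 c0).
have [B BE' B_ge0] : exists2 B : R,
    coord_moment (fun j => s j + tau) (fun=> 0) c i = B%:E & 0 <= B.
  apply: (@fin_le _ _ C); first exact: gmean_ge0.
  by rewrite -CE'; exact: coord_moment_le.
have := @coord_moment_le_inv_moment _ _ _ _ v0 c0 (smin + tau) c1 i.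
rewrite addr_gt0// => /(_ isT) H.
have {H} := H (fun j => lerD (smin_le j) (lexx tau)) c1_gt0 (hc1 i).
move: E; rewrite -[inv_moment _ _ _]/(gmean _ _ _) CE' BE'.
case: (bayes_mean _ _) => [l| |]//.
rewrite -!EFinM -!EFinD => -[E]; rewrite !lee_fin => H.
have : 0 <= c1 * s i ^+ 2 by rewrite mulr_ge0 ?sqr_ge0// ltW.
by move=> h; have := ler_wpM2l h H; move: E; rewrite /s; lra.
Qed.

End shrink.

(** * The limit c -> 0 and the minimax theorem *)

Section limit.
Context {R : realType} {n : nat} (sigma : 'I_n -> R) (c1 c : R).
Hypothesis s_gt0 : forall i, 0 < sigma i ^+ 2.
Hypothesis c_ge0 : 0 <= c.
Let s (i : 'I_n) : R := sigma i ^+ 2.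

(** At x = 0 the value is 0 for every c, which is why convergence holds there
    too when c = 0. *)
Lemma cvg_shrink_coord i (x : n.-tuple R) :
  shrink_coord s (c + k.+1%:R^-1) c1 i x @[k --> \oo] -->
  shrink_coord s c c1 i x.
Proof.
have [S0|S_neq0] := eqVneq (sqnorm (colv x)) 0.
  have x0 : tnth x i = 0.
    apply/eqP; rewrite -sqrf_eq0; move/eqP: S0.
    rewrite sqnorm_colv psumr_eq0; last by move=> j _; exact: sqr_ge0.
    by move=> /allP /(_ i); rewrite mem_index_enum => /(_ isT).
  rewrite /shrink_coord x0; under eq_fun do rewrite mulr0.
  by rewrite mulr0; exact: cvg_cst.
have S_gt0 : 0 < sqnorm (colv x) by rewrite lt0r S_neq0 sqnorm_ge0.
apply: cvgB; first exact: cvg_cst.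
apply: cvgM; last exact: cvg_cst.
apply: cvgM; last exact: cvg_cst.
apply: cvgM; first exact: cvg_cst.
apply: cvgV; first by rewrite gt_eqF// ltr_wpDl.
apply: cvgD; last exact: cvg_cst.
rewrite -[X in _ --> X]addr0; apply: cvgD; first exact: cvg_cst.
exact: cvg_harmonic.
Qed.

Lemma risk_shrink_lim (M : \bar R) theta :
  (forall k : nat, (risk (diag_cov sigma)
     (shrink s (c + k.+1%:R^-1) c1) theta <= M)%E) ->
  (risk (diag_cov sigma) (shrink s c c1) theta <= M)%E.
Proof.
move=> H; rewrite risk_gmean//; last exact: estimator_shrink.
have mt (a : R) : measurable_fun [set: n.-tuple R]
    (fun x => sqnorm (colv (shrink s a c1 x) - colv theta)).
  by apply: measurable_sqnormB => //; exact: estimator_shrink.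
apply: (gmean_fatou (F := fun k x =>
  sqnorm (colv (shrink s (c + k.+1%:R^-1) c1 x) - colv theta))) => //.
- by move=> k x; exact: sqnorm_ge0.
- move=> x; rewrite sqnormB_colv.
  under eq_fun do rewrite sqnormB_colv.
  apply: cvg_big => [|i _]; first exact: add_continuous.
  rewrite !tnth_mktuple; under eq_fun do rewrite tnth_mktuple.
  under eq_fun do rewrite expr2.
  by rewrite expr2; apply: cvgM; (apply: cvgB; last exact: cvg_cst);
    exact: cvg_shrink_coord.
- by move=> k; have := H k; rewrite risk_gmean//; exact: estimator_shrink.
Qed.

(** The ensemble risk is a single Gaussian mean of the posterior risk, which is
    continuous in the estimate, so Fatou's lemma is needed only once. *)
Lemma ensemble_risk_shrink_lim (M : \bar R) tau : 0 < tau ->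
  (forall k : nat, (ensemble_risk (diag_cov sigma)
     (shrink s (c + k.+1%:R^-1) c1) tau <= M)%E) ->
  (ensemble_risk (diag_cov sigma) (shrink s c c1) tau <= M)%E.
Proof.
move=> t0 H.
have postE (a : R) : ensemble_risk (diag_cov sigma) (shrink s a c1) tau =
    gmean (fun i => s i + tau) (fun=> 0) (post_risk s tau (shrink s a c1)).
  rewrite ensemble_riskE//; last exact: estimator_shrink.
  rewrite -bayes_risk_post//; last exact: estimator_shrink.
  apply: eq_integral => theta _; rewrite risk_gmean//; exact: estimator_shrink.
rewrite postE; apply: (gmean_fatou (F := fun k =>
  post_risk s tau (shrink s (c + k.+1%:R^-1) c1))).
- by move=> k; apply: measurable_post_risk; exact: estimator_shrink.
- by move=> k x; exact: post_risk_ge0.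
- move=> x; rewrite /post_risk.
  apply: cvg_big => [|i _]; first exact: add_continuous.
  apply: cvgD; first exact: cvg_cst.
  rewrite !tnth_mktuple; under eq_fun do rewrite tnth_mktuple.
  under eq_fun do rewrite expr2.
  by rewrite expr2; apply: cvgM; (apply: cvgB; last exact: cvg_cst);
    exact: cvg_shrink_coord.
- by move=> k; rewrite -postE.
Qed.

End limit.

Lemma ensemble_minimax_le (R : realType) (n : nat) (sigma : 'I_n -> R) delta :
  (forall i, 0 < sigma i ^+ 2) -> estimator delta ->
  (forall tau, 0 < tau ->
    (ensemble_risk (diag_cov sigma) delta tau <= (\sum_i sigma i ^+ 2)%:E)%E) ->
  ensemble_minimax (diag_cov sigma) delta.
Proof.
move=> s0 md H; split => //; apply/eqP; rewrite eq_le; apply/andP; split.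
- apply: (@le_trans _ _ (\sum_i sigma i ^+ 2)%:E).
    by apply: ge_ereal_sup => _ [tau + <-]; rewrite /= in_itv/= andbT; exact: H.
  by apply: le_ereal_inf_tmp => _ [d md' <-]; exact: max_ensemble_risk_ge.
- by apply: ereal_inf_lbound; exists delta.
Qed.

Lemma ordinary_minimax_le (R : realType) (n : nat) (sigma : 'I_n -> R) delta :
  (forall i, 0 < sigma i ^+ 2) -> estimator delta ->
  (forall theta,
    (risk (diag_cov sigma) delta theta <= (\sum_i sigma i ^+ 2)%:E)%E) ->
  ordinary_minimax (diag_cov sigma) delta.
Proof.
move=> s0 md H; split => //; apply/eqP; rewrite eq_le; apply/andP; split.
- apply: (@le_trans _ _ (\sum_i sigma i ^+ 2)%:E).
    by apply: ge_ereal_sup => _ [theta _ <-]; exact: H.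
  apply: le_ereal_inf_tmp => _ [d md' <-].
  apply: le_trans (max_ensemble_risk_ge s0 md') _.
  exact: max_ensemble_risk_le.
- by apply: ereal_inf_lbound; exists delta.
Qed.

Theorem theorem3p2 (R : realType) (n : nat) (sigma : 'I_n.+1 -> R) (c1 c2 : R)
  (p_ge3 : (3 <= n.+1)%N)
  (sigma_decr : forall i j : 'I_n.+1, (i < j)%N -> sigma j ^+ 2 < sigma i ^+ 2)
  (sigma_last_gt0 : 0 < sigma ord_max ^+ 2)
  (c1_gt0 : 0 < c1) (c2_ge0 : 0 <= c2) :
  let p : R := n.+1%:R in
  (c1 <= 2 * (p - 2) ->
   Num.max 0 (p * (c1 / (2 * (p - 2)) - sigma ord_max ^+ 2 / sigma ord0 ^+ 2))
     <= c2 ->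
   ensemble_minimax (diag_cov sigma) (shrinkage sigma c1 c2)) /\
  (c1 <= 2 * (\sum_i (sigma i ^+ 4 / sigma ord0 ^+ 4) - 2) ->
   ordinary_minimax (diag_cov sigma) (shrinkage sigma c1 c2)).
Proof.
move=> p.
have smin_le i : sigma ord_max ^+ 2 <= sigma i ^+ 2.
  have [->//|i_neq] := eqVneq i ord_max.
  apply/ltW/sigma_decr; rewrite ltn_neqAle leq_ord andbT.
  by apply: contra_neq i_neq => e; exact: val_inj.
have smax_ge i : sigma i ^+ 2 <= sigma ord0 ^+ 2.
  have [->//|i_neq] := eqVneq i ord0.
  by apply/ltW/sigma_decr; rewrite lt0n.
have s_gt0 i : 0 < sigma i ^+ 2 := lt_le_trans sigma_last_gt0 (smin_le i).
set c := c2 * sigma ord0 ^+ 2.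
have c_ge0 : 0 <= c by rewrite mulr_ge0// ltW.
have ck_gt0 (k : nat) : 0 < c + k.+1%:R^-1 by rewrite ltr_wpDl// invr_gt0.
rewrite shrinkageE -/c; split.
- move=> c1_le c2_ge; apply: ensemble_minimax_le => //.
    exact: estimator_shrink.
  move=> tau t0; apply: ensemble_risk_shrink_lim => // k.
  apply: (@ensemble_risk_shrink_le _ _ _ _ s_gt0 c1_gt0 _
    (sigma ord_max ^+ 2)) => //.
  move=> i; have p0 : 0 < p by rewrite ltr0n.
  have p2 : 0 < p - 2 by rewrite subr_gt0 ltr_nat.
  have : p * (c1 / (2 * (p - 2)) - sigma ord_max ^+ 2 / sigma ord0 ^+ 2) <= c2.
    by apply: le_trans c2_ge; rewrite le_max lexx orbT.
  rewrite -ler_pdivlMl// -(ler_pM2r (s_gt0 ord0)) mulrBl divfK ?gt_eqF//.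
  rewrite -/(c2 * _) => h.
  have ck : c / p <= (c + k.+1%:R^-1) / p.
    by rewrite ler_pM2r ?invr_gt0// lerDl invr_ge0.
  have hc : c1 * sigma ord0 ^+ 2 <=
      2 * (p - 2) * (sigma ord_max ^+ 2 + (c + k.+1%:R^-1) / p).
    rewrite -ler_pdivrMl ?mulr_gt0// mulrA [_^-1 * c1]mulrC -lerBlDl.
    by apply: le_trans h _; rewrite mulrC mulrA mulrC in ck *; exact: ck.
  have h1 : c1 * sigma i ^+ 2 <= c1 * sigma ord0 ^+ 2 by rewrite ler_pM2l.
  have h2 : c1 * tau <= 2 * (p - 2) * tau by rewrite ler_pM2r.
  rewrite mulrDr (le_trans (lerD (le_trans h1 hc) h2))//.
  by rewrite -mulrDr addrAC.
- move=> c1_le; apply: ordinary_minimax_le => //.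
    exact: estimator_shrink.
  move=> theta; apply: risk_shrink_lim => // k.
  apply: (@risk_shrink_le _ _ _ _ s_gt0 c1_gt0 _ (sigma ord0 ^+ 2)) => //.
  move: c1_le; rewrite -mulr_suml => c1_le.
  have s04 : 0 < sigma ord0 ^+ 4 by rewrite (exprM _ 2 2) exprn_gt0.
  rewrite -exprM; under eq_bigr do rewrite -exprM.
  rewrite -ler_pdivlMr// -mulrA; lra.
Qed.
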